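(* Let $h(x,y)=Bx+Ay-b$ with $A$ of full row rank, let the standing assumptions (S1)--(S3) of the context hold, and let $\delta=\Theta(\epsilon)$ with $\delta\le\mu_g/(2l_{f,1})$. Fix $x_0\in\mathbb{R}^{d_x}$. Then: (a) Projected gradient descent (gradient descent in $z$, gradient ascent in $v$ with projection onto $\mathbb{R}^{d_h}_+$) applied to $$\max_{v\in\mathbb{R}^{d_h}_+}\min_{z\in\mathbb{R}^{d_y}}\ g(x_0,z)+v^\top(Bx_0+Az-b)$$ finds $\hat v,\hat z$ with $\|\hat v-v^*(x_0)\|\le\delta$ and $\|\hat z-z^*(x_0)\|\le\delta$ with complexity $O(\log(\epsilon^{-1}))$. (b) Set $y_0=z_0=\hat z$, $u_0=v_0=\hat v$, $\alpha_0=h(x_0,y_0)$, $\beta_0=h(x_0,z_0)$. Then the algorithm SFLCB started at $(x_0,y_0',z_0',u_0,v_0)$, with suitable parameters $\rho_1,\rho_2,\eta_x,\eta_y,\eta_z,\eta_u,\eta_v>0$ independent of $\epsilon$, finds an $\epsilon$-stationary point of $\Phi_\delta$ (i.e. some iterate satisfies $\|\nabla\Phi_\delta(x_t)\|\le\epsilon$) with complexity $O(\epsilon^{-3})$. Hence the total complexity is $O(\epsilon^{-3}+\log(\epsilon^{-1}))=O(\epsilon^{-3})$.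
   Context: $f,g:\mathbb{R}^{d_x}\times\mathbb{R}^{d_y}\to\mathbb{R}$ are continuously differentiable; $A\in\mathbb{R}^{d_h\times d_y}$, $B\in\mathbb{R}^{d_h\times d_x}$, $b\in\mathbb{R}^{d_h}$; $\mathcal{Y}(x)=\{y\in\mathbb{R}^{d_y}:h(x,y)\le0\}$ (componentwise). Standing assumptions. (S1) For every $x\in\mathbb{R}^{d_x}$, $\mathcal{Y}(x)$ is nonempty, closed and convex, and $\Phi(x)=f(x,y^*(x))$, with $y^*(x)=\arg\min_{y\in\mathcal{Y}(x)}g(x,y)$, satisfies $\inf_x\Phi(x)>-\infty$. (S2) $f,\nabla f,\nabla g$ are Lipschitz on $\mathbb{R}^{d_x}\times\mathbb{R}^{d_y}$ with constants $l_{f,0},l_{f,1},l_{g,1}$. (S3) For each $x$, $g(x,\cdot)$ is $\mu_g$-strongly convex on $\mathbb{R}^{d_y}$, $\mu_g>0$. Notation. $z^*(x)=y^*(x)$; $$\Phi_\delta(x)=\min_{y\in\mathcal{Y}(x)}\max_{z\in\mathcal{Y}(x)}\Big\{f(x,y)+\tfrac1\delta[g(x,y)-g(x,z)]\Big\}.$$ $v^*(x)\in\mathbb{R}^{d_h}_+$ is the (unique, since $A$ has full row rank) Lagrange multiplier of the constraint $h(x,\cdot)\le0$ in the problem of minimizing $g(x,\cdot)$ over $\mathcal{Y}(x)$. $\delta=\Theta(\epsilon)$ means $c_1\epsilon\le\delta\le c_2\epsilon$ for fixed constants $c_2\ge c_1>0$. Complexity means number of (gradient) iterations; $O(\cdot)$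 is as $\epsilon\to0$ and hides constants depending on the problem data, $c_1,c_2$, $x_0$, the starting point of the projected gradient method and the algorithm parameters, but not on $\epsilon$. With slack variables $\alpha,\beta\in\mathbb{R}^{d_h}$ write $y'=(y^\top,\alpha^\top)^\top$, $z'=(z^\top,\beta^\top)^\top$, $\mathcal{P}_y=\mathbb{R}^{d_y}\times\mathbb{R}_-^{d_h}$ ($\mathbb{R}_-$ the nonpositive reals), $\Pi_{\mathcal{P}_y}$ the Euclidean projection, and $$K(x,y',z',u,v)=\delta f(x,y)+g(x,y)-g(x,z)+u^\top(h(x,y)-\alpha)-v^\top(h(x,z)-\beta)+\tfrac{\rho_1}{2}\|h(x,y)-\alpha\|^2-\tfrac{\rho_2}{2}\|h(x,z)-\beta\|^2.$$ Algorithm SFLCB: from initial $(x_0,y_0',z_0',u_0,v_0)$, for $t=0,1,2,\dots$: $u_{t+1}=u_t+\eta_u(h(x_t,y_t)-\alpha_t)$; $v_{t+1}=v_t+\eta_v(h(x_t,z_t)-\beta_t)$; $x_{t+1}=x_t-\eta_x\nabla_xK(x_t,y_t',z_t',u_{t+1},v_{t+1})$; $y'_{t+1}=\Pi_{\mathcal{P}_y}\{y'_t-\eta_y\nabla_{y'}K(x_t,y_t',z_t',u_{t+1},v_{t+1})\}$; $z'_{t+1}=\Pi_{\mathcal{P}_y}\{z'_t+\eta_z\nabla_{z'}K(x_t,y_t',z_t',u_{t+1},v_{t+1})\}$. *)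

(* Defs.v *)
From HB Require Import structures.
From mathcomp Require Export all_boot all_order all_algebra.
From mathcomp Require Export all_classical all_reals all_analysis.

Set Implicit Arguments.
Unset Strict Implicit.
Unset Printing Implicit Defensive.

Export Order.TTheory GRing.Theory Num.Theory.
Export numFieldNormedType.Exports.

Open Scope classical_set_scope.
Open Scope ring_scope.

(* A vector of R^n is a column 'cV[R]_n.  The library norm on matrices is the
   sup norm (same topology and differentiability), so the Euclidean norm, which
   the constants in the hypotheses refer to, is defined here. *)
Section euclidean.
Variables (R : realType) (n : nat).
Implicit Types (p q v w : 'cV[R]_n) (S : set 'cV[R]_n) (F : 'cV[R]_n -> R).

Definition dot v w : R := \sum_i v i ord0 * w i ord0.

Definition enorm v : R := Num.sqrt (\sum_i v i ord0 ^+ 2).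

(* Directional derivatives are total in the library: grad F p is meaningful
   only where F is differentiable. *)
Definition grad F p : 'cV[R]_n := \col_i 'D_(delta_mx i ord0) F p.

Definition continuously_differentiable F : Prop :=
  (forall p, differentiable F p) /\ continuous (grad F).

Definition strongly_convex (mu : R) F : Prop :=
  forall p q (t : R), 0 <= t <= 1 ->
    F (t *: p + (1 - t) *: q) <=
      t * F p + (1 - t) * F q - mu / 2 * t * (1 - t) * enorm (p - q) ^+ 2.

Definition argmin S F : 'cV[R]_n :=
  xget 0 [set p | S p /\ forall q, S q -> F p <= F q].

Definition eproj S p : 'cV[R]_n := argmin S (fun q => enorm (q - p)).

Definition nonneg_orthant : set 'cV[R]_n := [set v | forall i, 0 <= v i ord0].

Definition stationary (eps : R) F p : Prop :=
  differentiable F p /\ enorm (grad F p) <= eps.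

End euclidean.

Definition lipschitz_scalar (R : realType) n (l : R) (F : 'cV[R]_n -> R) : Prop :=
  0 <= l /\ forall p q, `|F p - F q| <= l * enorm (p - q).

Definition lipschitz_vector (R : realType) n m (l : R)
    (F : 'cV[R]_n -> 'cV[R]_m) : Prop :=
  0 <= l /\ forall p q, enorm (F p - F q) <= l * enorm (p - q).

(* The pair (x, y) is the stacked vector col_mx x y, so that gradients and
   Lipschitz constants of f and g are those of functions on R^(dx + dy). *)
Section bilevel.
Variables (R : realType) (dx dy dh : nat).
Variables (f g : 'cV[R]_(dx + dy) -> R).
Variables (A : 'M[R]_(dh, dy)) (B : 'M[R]_(dh, dx)) (b : 'cV[R]_dh).
Implicit Types (x : 'cV[R]_dx) (y z : 'cV[R]_dy) (u v : 'cV[R]_dh).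

Definition constr x y : 'cV[R]_dh := B *m x + A *m y - b.

Definition feasible x : set 'cV[R]_dy :=
  [set y | forall i, constr x y i ord0 <= 0].

Definition ystar x : 'cV[R]_dy :=
  argmin (feasible x) (fun y => g (col_mx x y)).

Definition Phi x : R := f (col_mx x (ystar x)).

(* Under the standing assumptions and for 0 < delta <= mug / (2 lf1), the inner sup
   and the outer inf are attained, so this is the min-max value. *)
Definition Phi_pen (delta : R) x : R :=
  inf [set sup [set f (col_mx x y)
                    + delta^-1 * (g (col_mx x y) - g (col_mx x z))
               | z in feasible x]
      | y in feasible x].

Definition lagrangian x z v : R := g (col_mx x z) + dot v (constr x z).

Definition is_multiplier x v : Prop :=
  [/\ nonneg_orthant v,
      grad (fun y => lagrangian x y v) (ystar x) = 0
    & forall i, v i ord0 * constr x (ystar x) i ord0 = 0].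

Definition vstar x : 'cV[R]_dh := xget 0 [set v | is_multiplier x v].

Definition assumption_S1 : Prop :=
  (forall x, [/\ feasible x !=set0, closed (feasible x)
               & convex_set (feasible x)])
  /\ has_lbound (range Phi).

Definition assumption_S2 (lf0 lf1 lg1 : R) : Prop :=
  [/\ lipschitz_scalar lf0 f, lipschitz_vector lf1 (grad f)
    & lipschitz_vector lg1 (grad g)].

Definition assumption_S3 (mug : R) : Prop :=
  0 < mug /\ forall x, strongly_convex mug (fun y => g (col_mx x y)).

(* One simultaneous projected gradient step on the saddle function
   lagrangian x0, with step sizes tau in z and sigma in v. *)
Definition pgd_step (tau sigma : R) x0 (s : 'cV[R]_dy * 'cV[R]_dh) :
    'cV[R]_dy * 'cV[R]_dh :=
  let: (z, v) := s in
  (z - tau *: grad (fun z => lagrangian x0 z v) z,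
   eproj (@nonneg_orthant R dh)
     (v + sigma *: grad (fun v => lagrangian x0 z v) v)).

Definition pgd (tau sigma : R) x0 (s0 : 'cV[R]_dy * 'cV[R]_dh) (k : nat) :=
  iter k (pgd_step tau sigma x0) s0.

(* y' = col_mx y alpha and z' = col_mx z beta. *)
Definition Kfun (delta rho1 rho2 : R) x (y' z' : 'cV[R]_(dy + dh)) u v : R :=
  let y := usubmx y' in let alpha := dsubmx y' in
  let z := usubmx z' in let beta := dsubmx z' in
  delta * f (col_mx x y) + g (col_mx x y) - g (col_mx x z)
  + dot u (constr x y - alpha) - dot v (constr x z - beta)
  + rho1 / 2 * enorm (constr x y - alpha) ^+ 2
  - rho2 / 2 * enorm (constr x z - beta) ^+ 2.

Definition Py : set 'cV[R]_(dy + dh) :=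
  [set w | forall i, dsubmx w i ord0 <= 0].

Record sflcb_state := SflcbState {
  st_x : 'cV[R]_dx;
  st_y : 'cV[R]_(dy + dh);
  st_z : 'cV[R]_(dy + dh);
  st_u : 'cV[R]_dh;
  st_v : 'cV[R]_dh }.

Definition sflcb_step (delta rho1 rho2 eta_x eta_y eta_z eta_u eta_v : R)
    (s : sflcb_state) : sflcb_state :=
  let: SflcbState x y' z' u v := s in
  let K := Kfun delta rho1 rho2 in
  let u1 := u + eta_u *: (constr x (usubmx y') - dsubmx y') in
  let v1 := v + eta_v *: (constr x (usubmx z') - dsubmx z') in
  SflcbState
    (x - eta_x *: grad (fun x => K x y' z' u1 v1) x)
    (eproj Py (y' - eta_y *: grad (fun w : 'cV[R]_(dy + dh) => K x w z' u1 v1) y'))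
    (eproj Py (z' + eta_z *: grad (fun w : 'cV[R]_(dy + dh) => K x y' w u1 v1) z'))
    u1 v1.

Definition sflcb_init x0 (zhat : 'cV[R]_dy) (vhat : 'cV[R]_dh) : sflcb_state :=
  let w := col_mx zhat (constr x0 zhat) in SflcbState x0 w w vhat vhat.

Definition sflcb (delta rho1 rho2 eta_x eta_y eta_z eta_u eta_v : R)
    (s0 : sflcb_state) (t : nat) : sflcb_state :=
  iter t (sflcb_step delta rho1 rho2 eta_x eta_y eta_z eta_u eta_v) s0.

Definition accurate (delta : R) x0 (s : 'cV[R]_dy * 'cV[R]_dh) : Prop :=
  enorm (s.2 - vstar x0) <= delta /\ enorm (s.1 - ystar x0) <= delta.

End bilevel.

(* Main.v *)
From HB Require Import structures.
Require Import Defs.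
From mathcomp Require Import ring lra.

Set Implicit Arguments.
Unset Strict Implicit.
Unset Printing Implicit Defensive.

(** Penalizing the lower level turns the bilevel problem into the minimization of
    [delta^-1 * Psi], where [Psi] is the difference of the optimal values of two
    strongly convex problems over the same polyhedron, with objectives
    [delta f + g] and [g] ([Phi_penE]). Both satisfy [regular] with constants that
    do not depend on [delta] ([regular_penalized]), and this uniformity is what
    allows parameters independent of the accuracy.

    The constraint is affine and [A] has full row rank. Hence each lower-level
    problem has a unique solution and a unique multiplier, both Lipschitz in the
    upper-level variable ([kkt_lipschitz]) and stable under perturbation of the
    objective ([kkt_perturb]). By the envelope formula ([envelope]) the optimal
    values, and so [Psi], are smooth, with the partial gradient of the Lagrangian
    as gradient.

    The inner iterations of both phases are instances of one primal-dual step.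
    For the difference of two runs a quadratic energy with a cross term between
    primal and dual variables decreases by a fixed factor
    ([energy_contraction]): strong monotonicity controls the primal variables,
    and the unprojected part of the primal update together with full row rank
    controls the multipliers. Applied to the projected gradient method
    ([pgd_map_contraction]), this yields the existence of multipliers by a fixed
    point argument and the logarithmic count ([pgd_complexity]). Applied to the
    step with slack variables ([slack_map_contraction]), it shows that the inner
    variables of SFLCB track the moving lower-level solutions.

    The sum of [Psi] and the two inner energies then decreases at each step by a
    multiple of the squared gradient of [Psi] ([sflcb_descent]). The warm start,
    accurate to [delta], makes the total possible decrease [O(delta)], while
    [eps]-stationarity of [delta^-1 * Psi] asks for a gradient of [Psi] below
    [delta * eps]. Hence [O(delta / (delta * eps) ^+ 2)] steps suffice, which
    is [O(eps ^- 3)] ([sflcb_complexity]). *)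

(** * Euclidean calculus on columns *)

Section Euclidean_calculus.
Variable R : realType.

Section Dot.
Variable n : nat.
Implicit Types (u v w : 'cV[R]_n) (a : R).

Lemma dotC v w : dot v w = dot w v.
Proof. by rewrite /dot; apply: eq_bigr => i _; rewrite mulrC. Qed.

Lemma dotDl u v w : dot (u + v) w = dot u w + dot v w.
Proof.
by rewrite /dot -big_split; apply: eq_bigr => i _; rewrite /= mxE mulrDl.
Qed.

Lemma dotZl a v w : dot (a *: v) w = a * dot v w.
Proof.
by rewrite /dot mulr_sumr; apply: eq_bigr => i _; rewrite mxE mulrA.
Qed.

Lemma dotNl v w : dot (- v) w = - dot v w.
Proof. by rewrite -scaleN1r dotZl mulN1r. Qed.

Lemma dotBl u v w : dot (u - v) w = dot u w - dot v w.
Proof. by rewrite dotDl dotNl. Qed.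

Lemma dotDr u v w : dot w (u + v) = dot w u + dot w v.
Proof. by rewrite dotC dotDl !(dotC w). Qed.

Lemma dotZr a v w : dot w (a *: v) = a * dot w v.
Proof. by rewrite dotC dotZl (dotC w). Qed.

Lemma dotNr v w : dot w (- v) = - dot w v.
Proof. by rewrite dotC dotNl (dotC w). Qed.

Lemma dotBr u v w : dot w (u - v) = dot w u - dot w v.
Proof. by rewrite dotDr dotNr. Qed.

Lemma dot0l v : dot 0 v = 0.
Proof. by rewrite -(scale0r 0) dotZl mul0r. Qed.

Lemma dot0r v : dot v 0 = 0.
Proof. by rewrite dotC dot0l. Qed.

Definition dotE := (dotDl, dotDr, dotNl, dotNr, dotZl, dotZr, dot0l, dot0r).

Lemma dot_ge0 v : 0 <= dot v v.
Proof. by apply: sumr_ge0 => i _; rewrite -expr2 sqr_ge0. Qed.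

Lemma dot_eq0 v : dot v v <= 0 -> v = 0.
Proof.
move=> v0; have : dot v v == 0 by rewrite eq_le v0 dot_ge0.
rewrite psumr_eq0 => [/allP v_0|i _]; last by rewrite -expr2 sqr_ge0.
apply/colP => i; rewrite mxE; apply/eqP.
by have := v_0 i (mem_index_enum i); rewrite /= mulf_eq0 orbb.
Qed.

Lemma enorm_sq v : enorm v ^+ 2 = dot v v.
Proof.
rewrite /enorm sqr_sqrtr; first by apply: eq_bigr => i _; rewrite expr2.
by apply: sumr_ge0 => i _; rewrite sqr_ge0.
Qed.

Lemma enorm_ge0 v : 0 <= enorm v.
Proof. exact: sqrtr_ge0. Qed.

Lemma enorm_le v a : 0 <= a -> dot v v <= a ^+ 2 -> enorm v <= a.
Proof. by move=> a0; rewrite -enorm_sq ler_sqr // ?nnegrE // enorm_ge0. Qed.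

Lemma dot_le v a : enorm v <= a -> dot v v <= a ^+ 2.
Proof.
by move=> va; rewrite -enorm_sq ler_sqr // nnegrE ?(le_trans (enorm_ge0 v)) ?enorm_ge0.
Qed.

Lemma enormN v : enorm (- v) = enorm v.
Proof. by congr Num.sqrt; apply: eq_bigr => i _; rewrite mxE sqrrN. Qed.

Lemma enormZ a v : enorm (a *: v) = `|a| * enorm v.
Proof.
rewrite /enorm -sqrtr_sqr -sqrtrM ?sqr_ge0 // mulr_sumr.
by congr Num.sqrt; apply: eq_bigr => i _; rewrite mxE exprMn.
Qed.

Lemma enorm0 : enorm (0 : 'cV[R]_n) = 0.
Proof. by rewrite -(scale0r 0) enormZ normr0 mul0r. Qed.

Lemma enorm_eq0 v : enorm v <= 0 -> v = 0.
Proof. by move/dot_le; rewrite expr0n => /dot_eq0. Qed.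

Lemma dot_young a v w : 0 < a -> 2 * dot v w <= a * dot v v + a^-1 * dot w w.
Proof.
move=> a0; have : 0 <= a * (a * dot v v) - 2 * (a * dot v w) + dot w w.
  by have := dot_ge0 (a *: v - w); rewrite !dotE (dotC w v); lra.
rewrite -(pmulr_rge0 _ (_ : 0 < a^-1)) ?invr_gt0 // => H; rewrite -subr_ge0.
by move: H; congr (is_true (0 <= _)); field; rewrite gt_eqF.
Qed.

(** Young's inequality with the weight that makes its two terms equal. *)
Lemma dot_cauchy v w : dot v w <= enorm v * enorm w.
Proof.
have [/enorm_eq0 ->|v0] := leP (enorm v) 0.
  by rewrite dot0l enorm0 mul0r.
have [/enorm_eq0 ->|w0] := leP (enorm w) 0.
  by rewrite dot0r enorm0 mulr0.
have := dot_young v w (divr_gt0 w0 v0); rewrite -!enorm_sq.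
have -> : enorm w / enorm v * enorm v ^+ 2
   + (enorm w / enorm v)^-1 * enorm w ^+ 2 = 2 * (enorm v * enorm w).
  by field; rewrite !gt_eqF.
by rewrite ler_pM2l.
Qed.

Lemma dot_cauchyN v w : - (enorm v * enorm w) <= dot v w.
Proof. by rewrite lerNl -dotNl (le_trans (dot_cauchy _ _)) // enormN. Qed.

Lemma enormD v w : enorm (v + w) <= enorm v + enorm w.
Proof.
apply: enorm_le; first by rewrite addr_ge0 ?enorm_ge0.
rewrite !dotE (dotC w v) sqrrD -!enorm_sq; have := dot_cauchy v w; lra.
Qed.

Lemma enorm_subC v w : enorm (v - w) = enorm (w - v).
Proof. by rewrite -enormN opprB. Qed.

Lemma dotD_le2 v w : dot (v + w) (v + w) <= 2 * dot v v + 2 * dot w w.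
Proof. by have := dot_ge0 (v - w); rewrite !dotE (dotC w v); lra. Qed.

End Dot.

Lemma dot_col_mx m n (a c : 'cV[R]_m) (b d : 'cV[R]_n) :
  dot (col_mx a b) (col_mx c d) = dot a c + dot b d.
Proof.
rewrite /dot big_split_ord; congr (_ + _); apply: eq_bigr => i _.
  by rewrite !col_mxEu.
by rewrite !col_mxEd.
Qed.

Lemma dot_mulmx m n (M : 'M[R]_(m, n)) v w :
  dot (M *m v) w = dot v (M^T *m w).
Proof.
rewrite /dot; under eq_bigr do rewrite mxE mulr_suml.
rewrite exchange_big; apply: eq_bigr => j _; rewrite mxE mulr_sumr.
by apply: eq_bigr => i _; rewrite mxE mulrCA mulrA.
Qed.

Lemma mulmx_bounded m n (M : 'M[R]_(m, n)) :
  exists2 c : R, 0 <= c & forall v, enorm (M *m v) <= c * enorm v.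
Proof.
pose r i := enorm (row i M)^T.
(* The sum of the row norms bounds the operator norm, since each row enters
   squared and is at most the sum. *)
exists (\sum_i r i); first by apply: sumr_ge0 => i _; exact: enorm_ge0.
move=> v; have rE i : `|(M *m v) i ord0| <= r i * enorm v.
  have -> : (M *m v) i ord0 = dot (row i M)^T v.
    by rewrite mxE; apply: eq_bigr => j _; rewrite !mxE.
  by rewrite ler_norml dot_cauchyN dot_cauchy.
have S0 : 0 <= \sum_i r i by apply: sumr_ge0 => i _; exact: enorm_ge0.
apply: enorm_le; first by rewrite mulr_ge0 ?enorm_ge0.
rewrite exprMn -enorm_sq enorm_sq.
have -> : dot (M *m v) (M *m v) = \sum_i `|(M *m v) i ord0| ^+ 2.
  by apply: eq_bigr => i _; rewrite real_normK ?num_real ?expr2.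
apply: (@le_trans _ _ (\sum_i r i ^+ 2 * enorm v ^+ 2)).
  apply: ler_sum => i _; rewrite -exprMn ler_sqr ?nnegrE //.
  by rewrite mulr_ge0 ?enorm_ge0.
rewrite -mulr_suml ler_wpM2r ?sqr_ge0 // expr2 mulr_suml.
apply: ler_sum => i _; rewrite expr2 ler_wpM2l ?enorm_ge0 //.
by rewrite (bigD1 i) //= lerDl sumr_ge0 // => j _; exact: enorm_ge0.
Qed.

(** Full row rank makes the transpose injective with a bounded left inverse:
    this is what recovers the multipliers from the gradients. *)
Lemma row_free_trmx_bound m n (A : 'M[R]_(m, n)) : row_free A ->
  exists2 c : R, 0 <= c & forall u, enorm u <= c * enorm (A^T *m u).
Proof.
move=> fA; have [c c0 cP] := mulmx_bounded (pinvmx A)^T.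
exists c => // u; apply: le_trans (cP _).
by rewrite mulmxA -trmx_mul mulmxVp // trmx1 mul1mx.
Qed.

Lemma enorm_usub m n (w : 'cV[R]_(m + n)) : enorm (usubmx w) <= enorm w.
Proof.
apply: enorm_le; rewrite ?enorm_ge0 // enorm_sq -{3 4}(vsubmxK w) dot_col_mx.
by rewrite lerDl dot_ge0.
Qed.

Lemma enorm_dsub m n (w : 'cV[R]_(m + n)) : enorm (dsubmx w) <= enorm w.
Proof.
apply: enorm_le; rewrite ?enorm_ge0 // enorm_sq -{3 4}(vsubmxK w) dot_col_mx.
by rewrite lerDr dot_ge0.
Qed.

Lemma usubmxB m n (w w' : 'cV[R]_(m + n)) :
  usubmx (w - w') = usubmx w - usubmx w'.
Proof. exact: linearB. Qed.

Lemma usubmxN m n (w : 'cV[R]_(m + n)) : usubmx (- w) = - usubmx w.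
Proof. exact: linearN. Qed.

Lemma usubmxD m n (w w' : 'cV[R]_(m + n)) :
  usubmx (w + w') = usubmx w + usubmx w'.
Proof. exact: linearD. Qed.

Lemma usubmxZ m n (a : R) (w : 'cV[R]_(m + n)) :
  usubmx (a *: w) = a *: usubmx w.
Proof. exact: linearZ. Qed.

Lemma dsubmxB m n (w w' : 'cV[R]_(m + n)) :
  dsubmx (w - w') = dsubmx w - dsubmx w'.
Proof. exact: linearB. Qed.

Lemma enorm_col_mx_le m n (v : 'cV[R]_m) (w : 'cV[R]_n) :
  enorm (col_mx v w) <= enorm v + enorm w.
Proof.
apply: enorm_le; first by rewrite addr_ge0 ?enorm_ge0.
by rewrite dot_col_mx -!enorm_sq; have := enorm_ge0 v; have := enorm_ge0 w; nra.
Qed.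

Lemma enorm_col_mx0 m n (v : 'cV[R]_m) :
  enorm (col_mx v (0 : 'cV[R]_n)) = enorm v.
Proof.
apply/le_anti/andP; split.
  by have := enorm_col_mx_le v (0 : 'cV[R]_n); rewrite enorm0 addr0.
by have := enorm_usub (col_mx v (0 : 'cV[R]_n)); rewrite col_mxKu.
Qed.

Lemma enorm_0col_mx m n (v : 'cV[R]_n) :
  enorm (col_mx (0 : 'cV[R]_m) v) = enorm v.
Proof.
apply/le_anti/andP; split.
  by have := enorm_col_mx_le (0 : 'cV[R]_m) v; rewrite enorm0 add0r.
by have := enorm_dsub (col_mx (0 : 'cV[R]_m) v); rewrite col_mxKd.
Qed.

(** * Projections and their variational inequality *)

Section Projection.
Variable n : nat.
Implicit Types (S : set 'cV[R]_n) (p q : 'cV[R]_n).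

(** [argmin] picks an unspecified minimizer, so it can be computed only where
    the minimizer is unique. *)
Lemma argmin_eq S (F : 'cV[R]_n -> R) p :
  S p -> (forall q, S q -> F p <= F q) ->
  (forall q, S q -> F q <= F p -> q = p) -> argmin S F = p.
Proof.
move=> Sp minp uniq; rewrite /argmin; case: xgetP => [q _ [Sq minq]|/(_ p) []//].
by apply: uniq => //; apply: minq.
Qed.

(** The variational characterization of the projection on a convex set. *)
Definition is_proj S p q := S q /\ forall r, S r -> dot (p - q) (r - q) <= 0.

(** The variational inequality makes the squared distance to [p] grow by at least
    the squared distance to [q]. *)
Lemma eprojP S p q : is_proj S p q -> eproj S p = q.
Proof.
move=> [Sq VI].
have E r : dot (r - p) (r - p) =
    dot (q - p) (q - p) + dot (r - q) (r - q) - 2 * dot (p - q) (r - q).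
  by rewrite !dotE (dotC q p) (dotC r p) (dotC r q); ring.
apply: argmin_eq => // r Sr.
  apply: enorm_le; rewrite ?enorm_ge0 // enorm_sq (E r).
  by have := VI _ Sr; have := dot_ge0 (r - q); lra.
move=> /dot_le; rewrite enorm_sq (E r) => H.
apply/eqP; rewrite -subr_eq0; apply/eqP/dot_eq0.
by have := VI _ Sr; lra.
Qed.

(** Adding the two variational inequalities shows firm nonexpansiveness. *)
Lemma proj_firm S p p' q q' : is_proj S p q -> is_proj S p' q' ->
  dot (q - q') (q - q') <= dot (q - q') (p - p').
Proof.
move=> [Sq VI] [Sq' VI']; have := VI _ Sq'; have := VI' _ Sq.
rewrite !dotE (dotC q q') (dotC p q) (dotC p q') (dotC p' q) (dotC p' q').
by rewrite -subr_ge0 => ? ?; lra.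
Qed.

Definition pospart p : 'cV[R]_n := \col_i Num.max (p i ord0) 0.
Definition negpart p : 'cV[R]_n := \col_i Num.min (p i ord0) 0.

Lemma proj_nonneg p : is_proj (@nonneg_orthant R n) p (pospart p).
Proof.
split=> [i|r Sr]; first by rewrite mxE le_max lexx orbT.
rewrite /dot; apply: sumr_le0 => i _; rewrite !mxE.
have := Sr i; move: (r i ord0) (p i ord0) => s t s0.
by case: (lerP t 0) => t0; nra.
Qed.

(** Complementarity is the fixed point equation of a projected ascent step: this
    links the optimality conditions to the algorithms. *)
Lemma proj_nonneg_fixed p q :
  is_proj (@nonneg_orthant R n) (p + q) p ->
  [/\ forall i, 0 <= p i ord0, forall i, q i ord0 <= 0
    & forall i, p i ord0 * q i ord0 = 0].
Proof.
move=> /eprojP; rewrite (eprojP (proj_nonneg _)) => /colP H.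
have {}H i := H i; have E i : Num.max (p i ord0 + q i ord0) 0 = p i ord0.
  by have := H i; rewrite !mxE.
split=> i; have := E i; move: (p i ord0) (q i ord0) => s t;
  case: (lerP (s + t) 0) => H1 H2; try lra; nra.
Qed.

Lemma proj_nonneg_fix p q :
  (forall i, 0 <= p i ord0) -> (forall i, q i ord0 <= 0) ->
  (forall i, p i ord0 * q i ord0 = 0) ->
  is_proj (@nonneg_orthant R n) (p + q) p.
Proof.
move=> p0 q0 pq; split=> // r Sr; rewrite addrC addKr dotBr.
have -> : dot q p = 0 by rewrite /dot big1 // => i _; rewrite mulrC.
rewrite subr0; apply: sumr_le0 => i _.
by have := Sr i; have := q0 i; nra.
Qed.

End Projection.

Lemma proj_Py m n (w : 'cV[R]_(m + n)) :
  is_proj (@Py R m n) w (col_mx (usubmx w) (negpart (dsubmx w))).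
Proof.
split=> [i|r Sr]; first by rewrite col_mxKd mxE ge_min lexx orbT.
rewrite -{1}(vsubmxK w) -(vsubmxK r) !opp_col_mx !add_col_mx subrr dot_col_mx.
rewrite dot0l add0r /dot; apply: sumr_le0 => i _; rewrite !mxE.
have := Sr i; rewrite mxE; set s := r _ _; set t := w _ _ => s0.
by case: (lerP t 0) => t0; nra.
Qed.

Lemma proj_Py_fix m n (w : 'cV[R]_(m + n)) (u : 'cV[R]_n) :
  (forall i, dsubmx w i ord0 <= 0) -> (forall i, 0 <= u i ord0) ->
  (forall i, u i ord0 * dsubmx w i ord0 = 0) ->
  is_proj (@Py R m n) (w + col_mx 0 u) w.
Proof.
move=> w0 u0 uw; split=> // r Sr; rewrite addrC addKr.
rewrite -(vsubmxK w) -(vsubmxK r) opp_col_mx add_col_mx dot_col_mx dot0l add0r.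
rewrite dotBr; have -> : dot u (dsubmx w) = 0 by rewrite /dot big1 // => i _.
by rewrite subr0; apply: sumr_le0 => i _; have := Sr i; have := u0 i; nra.
Qed.


End Euclidean_calculus.

(** * First-order expansions with quadratic remainder *)

Section Quadratic_expansion.
Variable R : realType.

Section Expansion.
Variable n : nat.
Implicit Types (F G : 'cV[R]_n -> R) (p h gr : 'cV[R]_n).

(** A quadratic remainder gives differentiability together with the value of the
    gradient, passes through the operations that build [lagrangian] and [Kfun],
    and is the form of smoothness that the envelope formula produces and the
    descent estimate consumes. *)
Definition qgrad F p gr := exists2 M : R, 0 <= M &
  forall h, `|F (p + h) - F p - dot gr h| <= M * dot h h.

Lemma dot_linear gr : linear (dot gr : 'cV[R]_n -> R).
Proof. by move=> a u v; rewrite dotDr dotZr. Qed.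

HB.instance Definition _ gr :=
  GRing.isLinear.Build R 'cV[R]_n R *:%R (dot gr) (dot_linear gr).

Lemma dot_continuous gr : continuous (dot gr : 'cV[R]_n -> R).
Proof.
rewrite /dot; apply: (continuous_big (op := +%R)) => [|i _ p].
  exact: add_continuous.
apply: (@cvgMl_tmp _ _ (nbhs p) _ _ (gr i ord0)).
exact: (@coord_continuous R n 1 i ord0 p).
Qed.

Lemma dot_mx_norm h : dot h h <= n%:R * `|h| ^+ 2.
Proof.
have -> : n%:R * `|h| ^+ 2 = \sum_(i < n) `|h| ^+ 2.
  by rewrite sumr_const card_ord mulr_natl.
apply: ler_sum => i _.
rewrite -expr2 -real_normK ?num_real // ler_sqr ?nnegrE //.
rewrite [leRHS]/Num.Def.normr /= mx_normrE; apply/bigmax_geP; right => /=.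
by exists (i, ord0).
Qed.

Lemma qgrad_diff F p gr : qgrad F p gr -> differentiable F p /\ grad F p = gr.
Proof.
move=> [M M0 FP].
have Mn : 0 < M * n%:R + 1 by rewrite ltr_wpDl // mulr_ge0 // ler0n.
have oF : F \o shift p = cst (F p) + (dot gr : 'cV[R]_n -> R)
    +o_ (0 : 'cV[R]_n) id.
  apply/eqaddoP => _/posnumP[e]; near=> h.
  rewrite (_ : _ h = F (p + h) - F p - dot gr h); last first.
    by rewrite /= -addrA -opprD addrC (addrC p) addrC.
  apply: le_trans (FP h) _.
  apply: (@le_trans _ _ (M * (n%:R * `|h| ^+ 2))).
    by rewrite ler_wpM2l // dot_mx_norm.
  rewrite expr2 !mulrA ler_wpM2r //.
  apply: (@le_trans _ _ ((M * n%:R + 1) * `|h|)).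
    by rewrite ler_wpM2r // lerDl.
  rewrite mulrC -ler_pdivlMr //; near: h.
  have H := @nbhs0_le R 'cV[R]_n _ (divr_gt0 (gt0 e) Mn).
  exact: H.
(* The expansion determines the differential, hence all partial derivatives. *)
have gE := @diff_unique R 'cV[R]_n R F (dot gr) p (@dot_continuous gr) oF.
have dF : differentiable F p.
  by apply/diff_locallyP; rewrite gE; split => //; exact: dot_continuous.
split=> //; apply/colP => i; rewrite mxE deriveE // gE /= /dot (bigD1 i) //=.
rewrite !mxE !eqxx mulr1 big1 ?addr0 // => j ji.
by rewrite !mxE (negbTE ji) mulr0.
Unshelve. all: by end_near. Qed.

Lemma qgrad_grad F p gr : qgrad F p gr -> grad F p = gr.
Proof. by move/qgrad_diff => []. Qed.

Lemma qgradD F G p a b : qgrad F p a -> qgrad G p b ->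
  qgrad (fun q => F q + G q) p (a + b).
Proof.
move=> [M M0 FP] [N N0 GP]; exists (M + N) => [|h]; first exact: addr_ge0.
have := FP h; have := GP h; rewrite dotDl mulrDl !ler_norml; lra.
Qed.

Lemma qgradZ c F p a : qgrad F p a -> qgrad (fun q => c * F q) p (c *: a).
Proof.
move=> [M M0 FP]; exists (`|c| * M) => [|h]; first by rewrite mulr_ge0.
by rewrite dotZl -!mulrBr normrM -mulrA ler_wpM2l.
Qed.

Lemma qgradN F p a : qgrad F p a -> qgrad (fun q => - F q) p (- a).
Proof.
move=> [M M0 FP]; exists M => // h.
by rewrite dotNl -!opprD normrN.
Qed.

Lemma qgradB F G p a b : qgrad F p a -> qgrad G p b ->
  qgrad (fun q => F q - G q) p (a - b).
Proof. by move=> Fa Gb; apply: qgradD Fa _; apply: qgradN. Qed.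

Lemma qgrad_cst c p : qgrad (fun=> c) p 0.
Proof.
by exists 0 => // h; rewrite subrr dot0l subr0 normr0 mul0r.
Qed.

Lemma qgrad_eq F G p a b : F =1 G -> a = b -> qgrad F p a -> qgrad G p b.
Proof. by move=> FG <- [M M0 FP]; exists M => // h; rewrite -!FG. Qed.

(** Mean value theorem along the segment from [p] to [p + h]. *)
Lemma qgrad_lipschitz F l p :
  (forall q, differentiable F q) -> lipschitz_vector l (grad F) ->
  forall h, `|F (p + h) - F p - dot (grad F p) h| <= l * dot h h.
Proof.
move=> dF [l0 lF] h.
have diffE q : 'd F q h = dot (grad F q) h.
  rewrite [in LHS](matrix_sum_delta h) (exchange_big_dep xpredT) //= big_ord1.
  rewrite linear_sum; apply: eq_bigr => i _.
  by rewrite linearZ /= -deriveE // mxE mulrC.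
pose L := fun t : R => p + t *: h.
have LD t : is_diff t L (fun s : R => s *: h).
  have -> : (fun s : R => s *: h) = cst 0 + (fun s : R => s *: h).
    by apply/funext => s /=; rewrite fctE add0r.
  exact: is_diffD.
have FD t : is_derive t (1 : R) (F \o L) (dot (grad F (L t)) h).
  have dL : differentiable L t by [].
  have dFL : differentiable (F \o L) t by exact: differentiable_comp.
  apply: DeriveDef; first exact: diff_derivable.
  by rewrite deriveE // diff_comp //= diff_val scale1r diffE.
have cF : {within `[0, 1], continuous (F \o L)}.
  apply: continuous_subspaceT => t; apply: differentiable_continuous.
  by apply: differentiable_comp.
have [c c01] := MVT ltr01 (fun t _ => FD t) cF.
rewrite subr0 mulr1 /= /L scale1r scale0r addr0 => ->.
move: c01; rewrite in_itv /= => /andP[c0 c1].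
rewrite -dotBl; have lc := lF (p + c *: h) p.
have lch : enorm (grad F (p + c *: h) - grad F p) <= l * enorm h.
  apply: (le_trans lc); rewrite addrC addKr enormZ gtr0_norm //.
  by rewrite ler_wpM2l // ler_piMl ?enorm_ge0 // ltW.
rewrite ler_norml; set v := _ - _ in lch *.
have := dot_cauchy v h; have := dot_cauchyN v h.
have : enorm v * enorm h <= l * dot h h.
  by rewrite -enorm_sq expr2 mulrA ler_wpM2r ?enorm_ge0.
by move=> *; apply/andP; split; lra.
Qed.

End Expansion.

Lemma qgrad_affine m n (F : 'cV[R]_m -> R) (M : 'M[R]_(m, n)) c p gr :
  qgrad F (M *m p + c) gr -> qgrad (fun q => F (M *m q + c)) p (M^T *m gr).
Proof.
move=> [N N0 FP]; have [k k0 kP] := mulmx_bounded M.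
exists (N * k ^+ 2) => [|h]; first by rewrite mulr_ge0 ?sqr_ge0.
rewrite mulmxDr (addrAC _ (M *m h)) dot_mulmx trmxK; apply: le_trans (FP _) _.
rewrite -mulrA ler_wpM2l //.
by rewrite -(enorm_sq h) -exprMn; exact/dot_le/kP.
Qed.

Lemma qgrad_dot n (u : 'cV[R]_n) p : qgrad (dot u) p u.
Proof.
by exists 0 => // h; rewrite dotDr (addrC (dot u p)) addrK subrr normr0 mul0r.
Qed.

Lemma qgrad_sqnorm n (p : 'cV[R]_n) : qgrad (fun q => enorm q ^+ 2) p (2 *: p).
Proof.
exists 1 => // h; rewrite !enorm_sq !dotE (dotC h p) mul1r.
rewrite ler_norml; have := dot_ge0 h; by move=> *; apply/andP; split; lra.
Qed.

End Quadratic_expansion.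

(** * Linear contraction of the primal-dual step *)

Section Primal_dual.
Variable R : realType.

Section Energy.
Variables (m k : nat) (C : 'M[R]_(k, m)) (eta sigma : R).
Implicit Types (w : 'cV[R]_m) (u : 'cV[R]_k).

(** The cross term makes this quadratic form a Lyapunov function: without it
    the plain weighted distance need not decrease, since the step is explicit
    in at least one of the two variables. *)
Definition energy w u :=
  eta^-1 * dot w w + sigma^-1 * dot u u + 2 * dot (C *m w) u.

(** The difference of the two sides is the energy of [s *: w1 - w2], divided by
    [s]. *)
Lemma energyD_le s w1 w2 u1 u2 : 0 < s ->
  (forall w u, 0 <= energy w u) ->
  energy (w1 + w2) (u1 + u2) <=
    (1 + s) * energy w1 u1 + (1 + s^-1) * energy w2 u2.
Proof.
move=> s0 P0; have := P0 (s *: w1 - w2) (s *: u1 - u2).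
have -> : energy (s *: w1 - w2) (s *: u1 - u2) =
    s * ((1 + s) * energy w1 u1 + (1 + s^-1) * energy w2 u2
         - energy (w1 + w2) (u1 + u2)).
  rewrite /energy !mulmxDr !mulmxN -!scalemxAr !dotE (dotC w2 w1) (dotC u2 u1).
  by move: eta^-1 sigma^-1 => a b; field; rewrite gt_eqF.
by rewrite pmulr_rge0 // subr_ge0.
Qed.

End Energy.

(** The hypotheses are those satisfied by the difference of two runs of a
    projected primal-dual step: firm nonexpansiveness of the two projections,
    with [p] the difference of the (strongly monotone, Lipschitz) gradients and
    [ut] the difference of the multipliers used in the primal step, which lies
    between the old and the new one according to [j]. Strong monotonicity
    makes the energy drop by multiples of the squares of [w] and of both
    increments; the last hypothesis, which is where full row rank enters, bounds
    the multipliers by these, so that the drop is a fixed fraction of the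
    energy. *)
Lemma energy_contraction m k (C : 'M[R]_(k, m)) (mu L K : R) :
  0 < mu -> 0 <= L -> 0 <= K ->
  exists eta sigma theta lo up : R,
  [/\ [/\ 0 < eta, 0 < sigma, 0 < theta < 1, 0 < lo & 0 < up],
    forall (w : 'cV[R]_m) (u : 'cV[R]_k),
      lo * (dot w w + dot u u) <= energy C eta sigma w u
                <= up * (dot w w + dot u u)
  & forall (j : R) (w w' p : 'cV[R]_m) (u u' ut : 'cV[R]_k), 0 <= j <= 1 ->
    ut = u' - j *: (u' - u) ->
    dot w' w' <= dot w' (w - eta *: (p + C^T *m ut)) ->
    dot u' u' <= dot u' (u + sigma *: (C *m w)) ->
    mu * dot w w <= dot w p -> dot p p <= L ^+ 2 * dot w w ->
    dot ut ut <= K * (dot w w + eta^-1 ^+ 2 * dot (w' - w) (w' - w)) ->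
    energy C eta sigma w' u' <= (1 - theta) * energy C eta sigma w u].
Proof.
move=> mu0 L0 K0; have [c c0 cP] := mulmx_bounded C.
have {}cP w : dot (C *m w) (C *m w) <= c ^+ 2 * dot w w.
  by rewrite -!enorm_sq -exprMn enorm_sq; exact/dot_le/cP.
have c20 := sqr_ge0 c; have L20 := sqr_ge0 L.
move: (c ^+ 2) (L ^+ 2) c20 L20 cP => {c0}c2 L2 c20 L20 cP.
have mu20 : 0 < mu ^+ 2 by rewrite exprn_gt0.
have den0 : 0 < 8 * (L2 + mu ^+ 2) by lra.
(* The step sizes make the three error terms of the expansion, of sizes
   [16 sigma c2], [4 eta L2] and [4 sigma c2], small against [mu] and [1 / eta]. *)
pose eta := mu / (8 * (L2 + mu ^+ 2)).
have den1 : 0 < 32 * (c2 + 1) by lra.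
pose sigma := mu / (32 * (c2 + 1)).
have eta0 : 0 < eta by rewrite divr_gt0.
have sigma0 : 0 < sigma by rewrite divr_gt0.
have etaE : 8 * eta * L2 + 8 * eta * mu ^+ 2 = mu.
  by rewrite /eta; field; apply: lt0r_neq0; lra.
have sigE : 32 * sigma * c2 + 32 * sigma = mu.
  by rewrite /sigma; field; apply: lt0r_neq0; lra.
clearbody eta sigma.
have etamu2 : 0 <= eta * mu ^+ 2 by rewrite mulr_ge0 // ltW.
have etaL2 : 0 <= eta * L2 by rewrite mulr_ge0 // ltW.
have etaL : 8 * eta * L2 <= mu by lra.
have etamu : 8 * eta * mu <= 1.
  by rewrite -(ler_pM2r mu0) mul1r; lra.
have sigc : 32 * sigma * c2 <= mu by rewrite -[leRHS]sigE lerDl; lra.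
have ei0 : 0 < eta^-1 by rewrite invr_gt0.
have si0 : 0 < sigma^-1 by rewrite invr_gt0.
have sce : 32 * sigma * c2 <= eta^-1 / 8.
  rewrite ler_pdivlMr // -[leRHS]mul1r ler_pdivlMr //; nra.
have low w u : eta^-1 / 2 * dot w w + sigma^-1 / 2 * dot u u
    <= energy C eta sigma w u.
  have s2 : 0 < 2 * sigma by lra.
  have := dot_young (- (C *m w)) u s2; rewrite !dotE /energy invfM.
  have := cP w; have := dot_ge0 w; have := dot_ge0 u; nra.
have upp w u : energy C eta sigma w u
    <= 2 * eta^-1 * dot w w + 2 * sigma^-1 * dot u u.
  have s2 : 0 < 2 * sigma by lra.
  have := dot_young (C *m w) u s2; rewrite /energy invfM.
  have := cP w; have := dot_ge0 w; have := dot_ge0 u; nra.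
(* The inverse of the rate: each summand absorbs one term of the upper bound on
   the energy into the decrease proved below. *)
pose q := 8 + 8 * K * sigma^-1 * eta^-1
  + (2 * eta^-1 + 4 * K * sigma^-1) / mu.
have q1 : 0 <= 8 * K * sigma^-1 * eta^-1 by rewrite !mulr_ge0 // ltW.
have q2 : 0 <= (2 * eta^-1 + 4 * K * sigma^-1) / mu.
  rewrite divr_ge0 //; last exact: ltW.
  by rewrite addr_ge0 // !mulr_ge0 // ltW.
have q8 : 8 <= q by rewrite /q; lra.
have th0 : 0 < q^-1 by rewrite invr_gt0; lra.
have th8 : 8 * q^-1 <= 1 by rewrite ler_pdivrMr; lra.
exists eta, sigma, q^-1, (Num.min (eta^-1 / 2) (sigma^-1 / 2)),
  (Num.max (2 * eta^-1) (2 * sigma^-1)); split.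
- split=> //; rewrite ?th0 ?lt_min ?lt_max ?divr_gt0 ?mulr_gt0 //=; lra.
- move=> w u; apply/andP; split.
    apply: le_trans (low w u); rewrite mulrDr lerD //.
      by rewrite ler_wpM2r ?dot_ge0 // ge_min lexx.
    by rewrite ler_wpM2r ?dot_ge0 // ge_min lexx orbT.
  apply: le_trans (upp w u) _; rewrite mulrDr lerD //.
    by rewrite ler_wpM2r ?dot_ge0 // le_max lexx.
  by rewrite ler_wpM2r ?dot_ge0 // le_max lexx orbT.
move=> j w w' p u u' ut /andP[j0 j1] utE Hw Hu Hmu HL HK.
pose e : 'cV[R]_m := w' - w; pose d : 'cV[R]_k := u' - u.
have w'E : w' = w + e by rewrite /e addrC subrK.
have u'E : u' = u + d by rewrite /d addrC subrK.
have utE' : ut = u + (1 - j) *: d.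
  by rewrite utE -/d scalerBl scale1r addrA -u'E.
rewrite -/e in HK; move: e d w'E u'E utE' HK => e d w'E u'E utE' HK.
have H1 : 2 * eta^-1 * (dot w e + dot e e) <= - 2 * (dot w p + dot e p)
   - 2 * (dot (C *m w) ut + dot (C *m e) ut).
  rewrite -(ler_pM2l eta0).
  have -> : eta * (2 * eta^-1 * (dot w e + dot e e)) = 2 * (dot w e + dot e e).
    by field; rewrite gt_eqF.
  by move: Hw; rewrite w'E !dotE !dot_mulmx (dotC e w); clear; lra.
have H2 : 2 * sigma^-1 * (dot u d + dot d d) <=
    2 * (dot (C *m w) u + dot (C *m w) d).
  rewrite -(ler_pM2l sigma0).
  have -> : sigma * (2 * sigma^-1 * (dot u d + dot d d))
      = 2 * (dot u d + dot d d) by field; rewrite gt_eqF.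
  by move: Hu; rewrite u'E !dotE (dotC d u) !(dotC _ (C *m w)); clear; lra.
have H3 : energy C eta sigma w' u' - energy C eta sigma w u <=
    - eta^-1 * dot e e - sigma^-1 * dot d d - 2 * (dot w p + dot e p)
    + 2 * dot ((1 + j) *: (C *m w)) d + 2 * dot (j *: (C *m e)) d.
  rewrite /energy w'E u'E !mulmxDr !dotE (dotC e w) (dotC d u).
  by move: H1 H2; rewrite utE' !dotE; clear; lra.
have s4 : 0 < 4 * sigma by rewrite mulr_gt0.
have e4 : 0 < 4 * eta by rewrite mulr_gt0.
(* With the weight [4 sigma], the two estimates involving [d] together use up
   half of its term in the decrease. *)
have Y1 := dot_young ((1 + j) *: (C *m w)) d s4.
have Y2 := dot_young (j *: (C *m e)) d s4.
have Y3 := dot_young (- p) e e4.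
move: Y1 Y2 Y3; rewrite ![dot (_ *: _) (_ *: _)]dotE !dotZr !invfM dotNl (dotC p e).
rewrite dotNl dotNr opprK => Y1 Y2 Y3.
have ww0 := dot_ge0 w; have ee0 := dot_ge0 e; have dd0 := dot_ge0 d.
have cw0 := dot_ge0 (C *m w); have ce0 := dot_ge0 (C *m e).
have jw : (1 + j) * ((1 + j) * dot (C *m w) (C *m w)) <= 4 * (c2 * dot w w).
  rewrite mulrA ler_pM ?cP ?mulr_ge0 ?addr_ge0 //.
  by move: j0 j1; clear; nra.
have je : j * (j * dot (C *m e) (C *m e)) <= c2 * dot e e.
  rewrite mulrA -[leRHS]mul1r ler_pM ?cP ?mulr_ge0 //.
  by move: j0 j1; clear; nra.
have {jw}jw : 4 * sigma * ((1 + j) * ((1 + j) * dot (C *m w) (C *m w)))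
    <= mu / 2 * dot w w.
  apply: (@le_trans _ _ (4 * sigma * (4 * (c2 * dot w w)))).
    by rewrite ler_pM2l.
  have -> : 4 * sigma * (4 * (c2 * dot w w)) = 16 * sigma * c2 * dot w w by ring.
  by rewrite ler_wpM2r //; move: sigc; clear; lra.
have {je}je : 4 * sigma * (j * (j * dot (C *m e) (C *m e)))
    <= eta^-1 / 64 * dot e e.
  apply: (@le_trans _ _ (4 * sigma * (c2 * dot e e))); first by rewrite ler_pM2l.
  by rewrite mulrA ler_wpM2r //; move: sce; clear; lra.
have pp : 4 * eta * dot p p <= mu / 2 * dot w w.
  apply: (@le_trans _ _ (4 * eta * (L2 * dot w w))); first by rewrite ler_pM2l.
  by rewrite mulrA ler_wpM2r //; move: etaL; clear; lra.
have ie0 : 0 <= eta^-1 * dot e e by rewrite mulr_ge0 // ltW.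
have id0 : 0 <= sigma^-1 * dot d d by rewrite mulr_ge0 // ltW.
have decrease : energy C eta sigma w' u' <= energy C eta sigma w u
    - mu * dot w w - eta^-1 / 2 * dot e e - sigma^-1 / 2 * dot d d.
  by move: H3 Y1 Y2 Y3 jw je pp ie0 Hmu; clear; lra.
suff H : q^-1 * energy C eta sigma w u <=
    mu * dot w w + eta^-1 / 2 * dot e e + sigma^-1 / 2 * dot d d.
  by move: H decrease; clear; lra.
have q0 : 0 < q by rewrite (lt_le_trans _ q8).
rewrite mulrC ler_pdivrMr //.
apply: le_trans (upp w u) _.
have uu : dot u u <= 2 * dot ut ut + 2 * dot d d.
  have -> : u = ut + - (1 - j) *: d by rewrite utE' scaleNr addrK.
  apply: le_trans (dotD_le2 _ _) _; rewrite lerD2l ler_pM2l // !dotE mulrA.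
  by rewrite ler_piMl //; move: j0 j1; clear; nra.
have {}uu : 2 * sigma^-1 * dot u u <= 4 * sigma^-1 *
    (K * (dot w w + eta^-1 ^+ 2 * dot e e)) + 4 * sigma^-1 * dot d d.
  apply: (@le_trans _ _ (2 * sigma^-1 * (2 *
      (K * (dot w w + eta^-1 ^+ 2 * dot e e)) + 2 * dot d d))).
    by rewrite ler_pM2l ?mulr_gt0 //; move: uu HK; clear; lra.
  by clear; lra.
have qw : (2 * eta^-1 + 4 * K * sigma^-1) * dot w w <= mu * q * dot w w.
  rewrite ler_wpM2r // (mulrC mu) -ler_pdivrMr // /q.
  by move: q1; clear; lra.
have qe : 8 * K * sigma^-1 * eta^-1 * (eta^-1 * dot e e)
    <= q * (eta^-1 * dot e e).
  by rewrite ler_wpM2r // /q; move: q2; clear; lra.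
have qd : 8 * (sigma^-1 * dot d d) <= q * (sigma^-1 * dot d d).
  by rewrite ler_wpM2r.
by move: uu qw qe qd; clear; lra.
Qed.

End Primal_dual.

(** * Optimality conditions of the lower-level problem *)

Section Lower_level.
Variables (R : realType) (dx dy dh : nat).
Implicit Types (F : 'cV[R]_(dx + dy) -> R) (x : 'cV[R]_dx) (y z : 'cV[R]_dy).
Implicit Types (u v : 'cV[R]_dh).

Definition gradx F x y : 'cV[R]_dx := usubmx (grad F (col_mx x y)).
Definition grady F x y : 'cV[R]_dy := dsubmx (grad F (col_mx x y)).

(** Both lower-level objectives that occur, [g] and [delta f + g], satisfy this
    with the same two constants, for all admissible [delta]. *)
Record regular (L mu : R) F : Prop := Regular {
  reg_expand : forall p h,
    `|F (p + h) - F p - dot (grad F p) h| <= L * dot h h;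
  reg_lip : forall p q, enorm (grad F p - grad F q) <= L * enorm (p - q);
  reg_mono : forall x y1 y2, mu * dot (y1 - y2) (y1 - y2) <=
    dot (y1 - y2) (grady F x y1 - grady F x y2);
  reg_cvx : forall x y1 y2,
    F (col_mx x y2) + dot (grady F x y2) (y1 - y2) <= F (col_mx x y1) }.

Lemma grady_lip L mu F : regular L mu F -> forall x1 x2 y1 y2,
  enorm (grady F x1 y1 - grady F x2 y2) <=
    L * enorm (col_mx (x1 - x2) (y1 - y2)).
Proof.
move=> [_ lF _ _] x1 x2 y1 y2; rewrite /grady -linearB /=.
apply: le_trans (enorm_dsub _) _.
by rewrite (le_trans (lF _ _)) // opp_col_mx add_col_mx.
Qed.

Lemma gradx_lip L mu F : regular L mu F -> forall x1 x2 y1 y2,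
  enorm (gradx F x1 y1 - gradx F x2 y2) <=
    L * enorm (col_mx (x1 - x2) (y1 - y2)).
Proof.
move=> [_ lF _ _] x1 x2 y1 y2; rewrite /gradx -linearB /=.
apply: le_trans (enorm_usub _) _.
by rewrite (le_trans (lF _ _)) // opp_col_mx add_col_mx.
Qed.

Lemma grady_lipy L mu F x y1 y2 : regular L mu F ->
  enorm (grady F x y1 - grady F x y2) <= L * enorm (y1 - y2).
Proof.
by move=> /grady_lip lF; have := lF x x y1 y2; rewrite subrr enorm_0col_mx.
Qed.

Lemma grady_lipx L mu F x1 x2 y : regular L mu F ->
  enorm (grady F x1 y - grady F x2 y) <= L * enorm (x1 - x2).
Proof.
by move=> /grady_lip lF; have := lF x1 x2 y y; rewrite subrr enorm_col_mx0.
Qed.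

Section Multipliers.
Variables (A : 'M[R]_(dh, dy)) (B : 'M[R]_(dh, dx)) (b : 'cV[R]_dh).

Local Notation h := (constr A B b).

Lemma constrBy x y z : h x y - h x z = A *m (y - z).
Proof.
by rewrite /constr mulmxBr opprB addrA subrK opprD addrACA subrr add0r.
Qed.

Lemma constrBx x1 x2 y : h x1 y - h x2 y = B *m (x1 - x2).
Proof.
by rewrite /constr mulmxBr opprB addrA subrK opprD addrACA subrr addr0.
Qed.

Record kkt F x y u : Prop := Kkt {
  kkt_grad : grady F x y + A^T *m u = 0;
  kkt_dual : forall i, 0 <= u i ord0;
  kkt_primal : forall i, h x y i ord0 <= 0;
  kkt_slack : forall i, u i ord0 * h x y i ord0 = 0 }.

Lemma kkt_dot F x y u : kkt F x y u -> dot u (h x y) = 0.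
Proof. by move=> [_ _ _ uh]; rewrite /dot big1. Qed.

Lemma dot_le0 u v : (forall i, 0 <= u i ord0) -> (forall i, v i ord0 <= 0) ->
  dot u v <= 0.
Proof.
by move=> u0 v0; apply: sumr_le0 => i _; rewrite mulr_ge0_le0.
Qed.

(** By convexity the solution minimizes the Lagrangian at its own multiplier,
    over infeasible points too. *)
Lemma kkt_lagrangian L mu F x y u z : regular L mu F -> kkt F x y u ->
  F (col_mx x y) <= F (col_mx x z) + dot u (h x z).
Proof.
move=> rF K; apply: le_trans (_ : F (col_mx x y) <=
    F (col_mx x y) + dot (grady F x y) (z - y) + dot u (h x z)) _; last first.
  by rewrite lerD2r (reg_cvx rF).
have -> : grady F x y = - (A^T *m u) by apply/eqP; rewrite -addr_eq0 (kkt_grad K).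
rewrite dotNl dot_mulmx trmxK -(constrBy x) dotBr (kkt_dot K) subr0.
by rewrite -addrA addNr addr0.
Qed.

Lemma kkt_min L mu F x y u z : regular L mu F -> kkt F x y u ->
  feasible A B b x z -> F (col_mx x y) <= F (col_mx x z).
Proof.
move=> rF K fz; apply: le_trans (kkt_lagrangian z rF K) _.
by rewrite gerDl; apply: dot_le0 => // i; exact: kkt_dual K i.
Qed.

(** When two optimality systems are subtracted, the complementarity terms have
    the favourable sign, and what remains besides the perturbation of the
    gradient is the displacement of the constraint. *)
Lemma kkt_monotone L mu F1 F2 x1 x2 y1 y2 u1 u2 e : regular L mu F1 ->
  kkt F1 x1 y1 u1 -> kkt F2 x2 y2 u2 ->
  enorm (grady F1 x1 y2 - grady F2 x2 y2) <= e ->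
  mu * enorm (y1 - y2) ^+ 2 <= e * enorm (y1 - y2)
    + enorm (u1 - u2) * enorm (B *m (x1 - x2)).
Proof.
move=> r1 K1 K2 eP; rewrite enorm_sq.
apply: le_trans (reg_mono r1 x1 y1 y2) _.
have -> : grady F1 x1 y1 - grady F1 x1 y2 = - (A^T *m (u1 - u2))
    - (grady F1 x1 y2 - grady F2 x2 y2).
  have -> : grady F1 x1 y1 = - (A^T *m u1).
    by apply/eqP; rewrite -addr_eq0 (kkt_grad K1).
  have -> : grady F2 x2 y2 = - (A^T *m u2).
    by apply/eqP; rewrite -addr_eq0 (kkt_grad K2).
  by rewrite mulmxBr opprB opprD opprK [RHS]addrC addrA subrK addrC.
rewrite dotBr addrC lerD //.
  have := dot_cauchyN (y1 - y2) (grady F1 x1 y2 - grady F2 x2 y2).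
  have := enorm_ge0 (y1 - y2); move: eP; rewrite mulrC; nra.
rewrite dotNr dotC dot_mulmx trmxK -(constrBy x1).
have -> : h x1 y1 - h x1 y2 = (h x1 y1 - h x2 y2) - B *m (x1 - x2).
  by rewrite -(constrBx _ _ y2) (opprB (h x1 y2)) addrA subrK.
rewrite dotBr opprB; apply: (@le_trans _ _ (dot (u1 - u2) (B *m (x1 - x2)))).
  rewrite gerDl oppr_le0 dotBl !(dotBr (h x1 y1)) (kkt_dot K1) (kkt_dot K2).
  rewrite sub0r subr0.
  rewrite -opprD oppr_ge0.
  have := dot_le0 (kkt_dual K1) (kkt_primal K2).
  have := dot_le0 (kkt_dual K2) (kkt_primal K1); lra.
exact: dot_cauchy.
Qed.

Hypothesis fullA : row_free A.

(** Stationarity expresses the image of the multiplier under the transpose of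
    [A] as a gradient, and full row rank lets one go back. *)
Lemma kkt_dual_dist : exists2 c : R, 0 <= c &
  forall (L mu : R) F1 F2 x1 x2 y1 y2 u1 u2 e, regular L mu F1 ->
  kkt F1 x1 y1 u1 -> kkt F2 x2 y2 u2 ->
  enorm (grady F1 x1 y2 - grady F2 x2 y2) <= e ->
  enorm (u1 - u2) <= c * (L * enorm (y1 - y2) + e).
Proof.
have [c c0 cP] := row_free_trmx_bound fullA; exists c => //.
move=> L mu F1 F2 x1 x2 y1 y2 u1 u2 e r1 K1 K2 eP.
apply: le_trans (cP _) _; rewrite ler_wpM2l //.
have -> : A^T *m (u1 - u2) = - ((grady F1 x1 y1 - grady F1 x1 y2)
    + (grady F1 x1 y2 - grady F2 x2 y2)).
  rewrite addrA subrK mulmxBr opprB.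
  have /eqP := kkt_grad K1; rewrite addrC addr_eq0 => /eqP ->.
  by have /eqP := kkt_grad K2; rewrite addrC addr_eq0 => /eqP ->; rewrite opprK addrC.
rewrite enormN; apply: le_trans (enormD _ _) _; apply: lerD => //.
exact: grady_lipy r1.
Qed.

(** [kkt_monotone] with the multipliers bounded through [kkt_dual_dist] is a
    quadratic inequality in the two distances, whose solution is linear. *)
Lemma kkt_lipschitz (L mu : R) : 0 <= L -> 0 < mu -> exists2 c : R, 0 <= c &
  forall F x1 x2 y1 y2 u1 u2, regular L mu F ->
  kkt F x1 y1 u1 -> kkt F x2 y2 u2 ->
  enorm (y1 - y2) <= c * enorm (x1 - x2) /\
  enorm (u1 - u2) <= c * enorm (x1 - x2).
Proof.
move=> L0 mu0; have [k k0 kP] := kkt_dual_dist.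
have [B0 B00 BP] := mulmx_bounded B.
pose P : R := (L + 2 * k * L * B0) / mu.
have kL : 0 <= k * L by rewrite mulr_ge0.
have kLB : 0 <= k * L * B0 by rewrite mulr_ge0.
have P0 : 0 <= P by rewrite divr_ge0 ?(ltW mu0) //; lra.
have muP : mu * P = L + 2 * (k * L * B0) by rewrite /P; field; rewrite gt_eqF.
clearbody P; exists (1 + P + k * L * (2 + P)) => [|F x1 x2 y1 y2 u1 u2 rF K1 K2].
  by have := mulr_ge0 kL P0; lra.
have eP := grady_lipx x1 x2 y2 rF.
have uP := kP _ _ _ _ _ _ _ _ _ _ _ rF K1 K2 eP.
have yP := kkt_monotone rF K1 K2 eP.
have {}yP := le_trans yP (lerD (lexx _)
  (ler_wpM2l (enorm_ge0 _) (BP (x1 - x2)))).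
have a0 := enorm_ge0 (y1 - y2); have d0 := enorm_ge0 (u1 - u2).
have t0 := enorm_ge0 (x1 - x2).
move: (enorm (y1 - y2)) (enorm (u1 - u2)) (enorm (x1 - x2)) a0 d0 t0 uP yP.
move=> a d t a0 d0 t0 uP yP {K1 K2 eP kP BP}.
have Bt : 0 <= B0 * t by rewrite mulr_ge0.
have {}yP : mu * a ^+ 2 <= L * t * a + k * L * (a + t) * (B0 * t).
  apply: le_trans yP _; rewrite lerD2l ler_wpM2r //.
  by apply: le_trans uP _; lra.
(* Otherwise [t < a], every term on the right of [yP] is at most a multiple of
   [t * a], and division by [a] gives [a <= P * t]. *)
have yle : a <= (1 + P) * t.
  rewrite leNgt; apply/negP => ta.
  have tla : t < a by apply: le_lt_trans ta; rewrite mulrDl mul1r lerDl mulr_ge0.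
  have a1 : 0 < a by apply: le_lt_trans tla.
  have H1 : k * L * B0 * (t * t) <= k * L * B0 * (t * a).
    by rewrite ler_wpM2l // ler_wpM2l // ltW.
  have : mu * a ^+ 2 <= mu * P * t * a.
    by apply: le_trans yP _; rewrite muP; move: H1; lra.
  rewrite expr2 !mulrA ler_pM2r // -!mulrA ler_pM2l // => aP.
  have PPt : P * t <= (1 + P) * t by rewrite ler_wpM2r // lerDr.
  by have := le_lt_trans (le_trans aP PPt) ta; rewrite ltxx.
have kLP : 0 <= k * L * (2 + P) * t by rewrite !mulr_ge0 //; lra.
split; first by rewrite mulrDl; lra.
apply: le_trans uP _; apply: (@le_trans _ _ (k * L * (2 + P) * t)).
  have -> : k * (L * a + L * t) = k * L * (a + t) by ring.
  by rewrite -[leRHS]mulrA ler_wpM2l //; lra.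
by rewrite [leRHS]mulrDl lerDr mulr_ge0 //; lra.
Qed.

(** A perturbation of the gradient by [e] moves the solution by [O(e)]: applied
    to [g] and [delta f + g], this is why a warm start for the former is within
    [O(delta)] of the solution of the latter. *)
Lemma kkt_perturb (L mu : R) : 0 <= L -> 0 < mu -> exists2 c : R, 0 <= c &
  forall F1 F2 x y1 y2 u1 u2 e, regular L mu F1 ->
  kkt F1 x y1 u1 -> kkt F2 x y2 u2 ->
  enorm (grady F1 x y2 - grady F2 x y2) <= e ->
  mu * enorm (y1 - y2) <= e /\ enorm (u1 - u2) <= c * e.
Proof.
move=> L0 mu0; have [k k0 kP] := kkt_dual_dist.
exists (k * (L / mu + 1)) => [|F1 F2 x y1 y2 u1 u2 e r1 K1 K2 eP].
  by rewrite mulr_ge0 // addr_ge0 // divr_ge0 // ltW.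
have e0 := le_trans (enorm_ge0 _) eP.
have yle : mu * enorm (y1 - y2) <= e.
  have := kkt_monotone r1 K1 K2 eP; rewrite subrr mulmx0 enorm0 mulr0 addr0.
  have [/enorm_eq0 -> _|a0] := leP (enorm (y1 - y2)) 0.
    by rewrite enorm0 mulr0.
  by rewrite expr2 mulrA ler_pM2r.
split=> //; apply: le_trans (kP _ _ _ _ _ _ _ _ _ _ _ r1 K1 K2 eP) _.
rewrite -mulrA ler_wpM2l // mulrDl mul1r lerD2r -mulrA ler_wpM2l //.
by rewrite mulrC ler_pdivlMr // mulrC.
Qed.

End Multipliers.
End Lower_level.

(** * Projected gradient on the Lagrangian, and existence of multipliers *)

Section Geometric.
Variable R : realType.

(** From [1 - theta <= expR (- theta)]. *)
Lemma geometric_small (theta D e : R) n : 0 < theta < 1 -> 0 < D -> 0 < e ->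
  ln (D / e) <= theta * n%:R -> (1 - theta) ^+ n * D <= e.
Proof.
move=> /andP[t0 t1] D0 e0 nP.
have De : 0 < D / e by rewrite divr_gt0.
rewrite -ler_pdivlMr //; apply: (@le_trans _ _ (expR (- theta) ^+ n)).
  rewrite lerXn2r ?nnegrE ?expR_ge0 ?subr_ge0 ?(ltW t1) //.
  exact: expR_ge1Dx.
rewrite -expRM_natl mulrN mulrC expRN.
rewrite -[leRHS]invrK lef_pV2 ?posrE ?expR_gt0 ?invr_gt0 ?divr_gt0 //.
by rewrite invf_div -[leLHS]lnK ?posrE // ler_expR.
Qed.

Lemma iter_contraction (T : Type) (P : T -> R) (f : T -> T) theta : theta <= 1 ->
  (forall s, P (f s) <= (1 - theta) * P s) ->
  forall n s, P (iter n f s) <= (1 - theta) ^+ n * P s.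
Proof.
move=> t1 fP; elim=> [|n IH] s; first by rewrite expr0 mul1r.
rewrite iterS exprS -mulrA; apply: le_trans (fP _) _.
by rewrite ler_wpM2l ?subr_ge0.
Qed.

(** If every decrement before [N] exceeded [s], the potential would fall below
    its lower bound. *)
Lemma telescope_exists (V a : nat -> R) (lb s : R) N :
  (forall t, V t.+1 <= V t - a t) -> (forall t, lb <= V t) ->
  V 0 - lb <= N%:R * s -> 0 < s -> exists2 t, (t <= N)%N & a t <= s.
Proof.
move=> Vd Vlb VN s0; apply: contrapT => H.
have aN t : (t <= N)%N -> s < a t.
  by move=> tN; rewrite ltNge; apply/negP => ats; apply: H; exists t.
have Vt t : (t <= N.+1)%N -> V t <= V 0 - t%:R * s.
  elim: t => [|t IH] tN; first by rewrite mul0r subr0.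
  have := Vd t; have := IH (ltnW tN); have := aN _ tN.
  by rewrite -natr1 mulrDl mul1r; clear; lra.
have := Vt _ (leqnn _); have := Vlb N.+1.
by move: VN s0; rewrite -natr1 mulrDl mul1r; clear; lra.
Qed.

End Geometric.

Section Column_map.
Variables (R : realType) (n : nat).

(** Completeness and norm are joined for the fixed point theorem. *)
HB.instance Definition _ := Complete.on 'cV[R]_n.

Lemma mx_norm_enorm (p : 'cV[R]_n) : `|p| ^+ 2 <= dot p p.
Proof.
rewrite -enorm_sq ler_sqr ?nnegrE ?enorm_ge0 //.
rewrite [leLHS]/Num.Def.normr /= mx_normrE; apply/bigmax_leP; split=> [|[i j] _].
  exact: enorm_ge0.
rewrite (ord1 j) /= -[leLHS]sqrtr_sqr ler_wsqrtr //.
by rewrite (bigD1 i) //= lerDl sumr_ge0 // => k _; rewrite sqr_ge0.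
Qed.

(** Since all norms are equivalent, some iterate contracts the ambient norm, and
    the fixed point of a contracting iterate is fixed by the map itself. *)
Lemma eventual_contraction_fixpoint (T : 'cV[R]_n -> 'cV[R]_n) :
  (forall e : R, 0 < e -> exists N, forall p q,
     dot (iter N T p - iter N T q) (iter N T p - iter N T q)
       <= e * dot (p - q) (p - q)) ->
  exists p, T p = p.
Proof.
move=> Tc; have n1 : (0 : R) < (4 * (n%:R + 1)) by rewrite mulr_gt0 // ltr_wpDl.
have i0 : (0 : R) < (4 * (n%:R + 1))^-1 by rewrite invr_gt0.
have [N NP] := Tc _ i0.
pose TN := fun p => iter N T p.
have fTN : set_fun setT setT TN by [].
have cTN : contraction (2^-1)%:nng (mkfun fTN).
  split=> /=; first by rewrite invf_lt1 // ltr1n.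
  move=> [p q] _ /=; rewrite /TN.
  have /= := mx_norm_enorm (iter N T p - iter N T q).
  move=> /le_trans /(_ (NP p q)) H.
  rewrite -ler_sqr ?nnegrE ?mulr_ge0 ?invr_ge0 //.
  apply: le_trans H _; rewrite mulrC ler_pdivrMr //.
  apply: le_trans (dot_mx_norm _) _.
  rewrite exprMn; have := sqr_ge0 `|p - q|; have : (0 : R) <= n%:R by [].
  by move: (`|p - q| ^+ 2) (n%:R : R) => s t; clear; nra.
have T0 : [set: 'cV[R]_n] !=set0 by exists 0.
have icTN : is_contraction (mkfun fTN) by exists (2^-1)%:nng.
have [p _ pE] := banach_fixed_point icTN closedT T0.
exists p; have {}pE : iter N T p = p by rewrite {2}pE.
(* [T p] is again fixed by the iterate, which contracts. *)
have := NP (T p) p; rewrite -iterSr iterS pE => H.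
apply/eqP; rewrite -subr_eq0; apply/eqP/dot_eq0.
have := dot_ge0 (T p - p).
move: (dot _ _) H => s; rewrite -ler_pdivrMl ?invr_gt0 // invrK.
by have : (0 : R) <= n%:R by []; move: (n%:R : R) => t; clear; nra.
Qed.

End Column_map.

Section Projected_gradient.
Variables (R : realType) (dx dy dh : nat).
Variables (A : 'M[R]_(dh, dy)) (B : 'M[R]_(dh, dx)) (b : 'cV[R]_dh).
Implicit Types (F : 'cV[R]_(dx + dy) -> R) (x : 'cV[R]_dx) (y z : 'cV[R]_dy).
Implicit Types (u v : 'cV[R]_dh) (s : 'cV[R]_dy * 'cV[R]_dh).

Local Notation h := (constr A B b).
Local Notation kkt := (kkt A B b).

Lemma qgrad_coly F x y gr : qgrad F (col_mx x y) gr ->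
  qgrad (fun y => F (col_mx x y)) y (dsubmx gr).
Proof.
move=> [M M0 FP]; exists M => // k; have := FP (col_mx 0 k).
by rewrite add_col_mx addr0 -{1}(vsubmxK gr) !dot_col_mx dot0r dot0l !add0r.
Qed.

Lemma qgrad_colx F x y gr : qgrad F (col_mx x y) gr ->
  qgrad (fun x => F (col_mx x y)) x (usubmx gr).
Proof.
move=> [M M0 FP]; exists M => // k; have := FP (col_mx k 0).
by rewrite add_col_mx addr0 -{1}(vsubmxK gr) !dot_col_mx dot0r dot0l !addr0.
Qed.

Definition pgd_map F (tau sigma : R) x s :=
  (s.1 - tau *: (grady F x s.1 + A^T *m s.2),
   pospart (s.2 + sigma *: h x s.1)).

Lemma kkt_pgd_map F tau sigma x y u : 0 < sigma ->
  kkt F x y u -> pgd_map F tau sigma x (y, u) = (y, u).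
Proof.
move=> s0 [gK uK hK sK]; rewrite /pgd_map /= gK scaler0 subr0; congr pair.
rewrite -(eprojP (proj_nonneg _)); apply/eprojP/proj_nonneg_fix => // i.
  by rewrite mxE pmulr_rle0.
by rewrite mxE mulrCA sK mulr0.
Qed.

Lemma pgd_map_kkt F tau sigma x y u : 0 < tau -> 0 < sigma ->
  pgd_map F tau sigma x (y, u) = (y, u) -> kkt F x y u.
Proof.
move=> t0 s0 [/eqP]; rewrite -subr_eq0 addrAC subrr sub0r oppr_eq0.
rewrite scaler_eq0 gt_eqF //= => /eqP gE uE.
have [u0 h0 uh] : [/\ forall i, 0 <= u i ord0,
    forall i, (sigma *: h x y) i ord0 <= 0
  & forall i, u i ord0 * (sigma *: h x y) i ord0 = 0].
  by apply: proj_nonneg_fixed; rewrite -{2}uE; exact: proj_nonneg.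
split=> // i; first by have := h0 i; rewrite mxE pmulr_rle0.
have := uh i; rewrite mxE mulrCA => /eqP.
by rewrite mulf_eq0 gt_eqF //= => /eqP.
Qed.

Hypothesis fullA : row_free A.

(** The simultaneous step uses the old multiplier in the primal update, which is
    the case [j = 1] of [energy_contraction]. Since the primal update is not
    projected, it determines the image of the multiplier under the transpose
    of [A]; full row rank then bounds the multiplier. *)
Lemma pgd_map_contraction (L mu : R) : 0 <= L -> 0 < mu ->
  exists tau sigma theta lo up : R,
  [/\ [/\ 0 < tau, 0 < sigma, 0 < theta < 1, 0 < lo & 0 < up],
    forall (w : 'cV[R]_dy) (u : 'cV[R]_dh),
      lo * (dot w w + dot u u) <= energy A tau sigma w u
                <= up * (dot w w + dot u u)
  & forall F x s t, regular L mu F ->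
    let s' := pgd_map F tau sigma x s in let t' := pgd_map F tau sigma x t in
    energy A tau sigma (s'.1 - t'.1) (s'.2 - t'.2) <=
      (1 - theta) * energy A tau sigma (s.1 - t.1) (s.2 - t.2)].
Proof.
move=> L0 mu0; have [k k0 kP] := row_free_trmx_bound fullA.
pose K : R := 2 * k ^+ 2 * (L ^+ 2 + 1).
have K0 : 0 <= K by rewrite !mulr_ge0 ?addr_ge0 ?sqr_ge0.
have [tau [sigma [theta [lo [up [pos bnd step]]]]]] :=
  energy_contraction A mu0 L0 K0.
exists tau, sigma, theta, lo, up; split=> // F x [z v] [z' v'] rF /=.
have [t0 s0 _ _ _] := pos.
set p := grady F x z - grady F x z'.
have LP : dot p p <= L ^+ 2 * dot (z - z') (z - z').
  by rewrite -(enorm_sq (z - z')) -exprMn dot_le ?(grady_lipy _ _ _ rF).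
have eE : z - tau *: (grady F x z + A^T *m v)
    - (z' - tau *: (grady F x z' + A^T *m v'))
    = (z - z') - tau *: (p + A^T *m (v - v')).
  have -> : p + A^T *m (v - v') = grady F x z + A^T *m v
      - (grady F x z' + A^T *m v').
    by rewrite mulmxBr opprD addrACA.
  by rewrite scalerBr !opprB addrACA [RHS]addrACA [in RHS](addrC (- z')).
apply: (step 1 _ _ p _ _ (v - v')) => //.
- by rewrite ler01 lexx.
- by rewrite scale1r subKr.
- by rewrite eE.
- have -> : v - v' + sigma *: (A *m (z - z'))
      = v + sigma *: h x z - (v' + sigma *: h x z').
    by rewrite -(constrBy A B b x) scalerBr opprD addrACA.
  by apply: (proj_firm (proj_nonneg _) (proj_nonneg _)).
- exact: (reg_mono rF x z z').
have {}eE : A^T *m (v - v') = - (p + tau^-1 *: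
    (z - tau *: (grady F x z + A^T *m v)
     - (z' - tau *: (grady F x z' + A^T *m v')) - (z - z'))).
  rewrite eE [_ - (z - z')]addrAC subrr sub0r scalerN scalerA mulVf ?gt_eqF // scale1r.
  by rewrite opprB [RHS]addrC addKr.
move: eE; set e := _ - (z - z') => eE.
have vP : dot (v - v') (v - v') <=
    k ^+ 2 * dot (A^T *m (v - v')) (A^T *m (v - v')).
  by rewrite -[X in _ * X]enorm_sq -exprMn dot_le.
apply: (le_trans vP); rewrite eE dotNl dotNr opprK.
have := dotD_le2 p (tau^-1 *: e).
have -> : dot (tau^-1 *: e) (tau^-1 *: e) = tau^-1 ^+ 2 * dot e e.
  by rewrite dotZl dotZr mulrA expr2.
move=> H.
have k20 := sqr_ge0 k; have L20 := sqr_ge0 L.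
have e0 : 0 <= tau^-1 ^+ 2 * dot e e by rewrite mulr_ge0 ?sqr_ge0 ?dot_ge0.
have w0 := dot_ge0 (z - z').
apply: (@le_trans _ _ (k ^+ 2 * (2 * (L ^+ 2 * dot (z - z') (z - z'))
   + 2 * (tau^-1 ^+ 2 * dot e e)))).
  by rewrite ler_wpM2l //; apply: le_trans H _; rewrite lerD2r ler_pM2l.
have -> : K * (dot (z - z') (z - z') + tau^-1 ^+ 2 * dot e e) = k ^+ 2 *
    (2 * ((L ^+ 2 + 1) * (dot (z - z') (z - z') + tau^-1 ^+ 2 * dot e e))).
  by rewrite /K; ring.
rewrite ler_wpM2l //.
have Le : 0 <= L ^+ 2 * (tau^-1 ^+ 2 * dot e e) by rewrite mulr_ge0.
by lra.
Qed.

(** The solution and its multiplier are obtained together, as the fixed point of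
    the projected gradient step. *)
Lemma kkt_exists (L mu : R) F x : 0 <= L -> 0 < mu -> regular L mu F ->
  exists y u, kkt F x y u.
Proof.
move=> L0 mu0 rF.
have [tau [sigma [theta [lo [up [[t0 s0 th0 lo0 up0] bnd step]]]]]] :=
  pgd_map_contraction L0 mu0.
have th1 : theta <= 1 by case/andP: th0 => _ /ltW.
pose enc (s : 'cV[R]_dy * 'cV[R]_dh) := col_mx s.1 s.2.
pose dec (p : 'cV[R]_(dy + dh)) := (usubmx p, dsubmx p).
have decK p : enc (dec p) = p by exact: vsubmxK.
have encK s : dec (enc s) = s by case: s => a c; rewrite /dec col_mxKu col_mxKd.
pose T p := enc (pgd_map F tau sigma x (dec p)).
have TE n p : dec (iter n T p) = iter n (pgd_map F tau sigma x) (dec p).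
  by elim: n => //= n <-; rewrite /T encK.
have [p Tp] : exists p, T p = p.
  apply: eventual_contraction_fixpoint => e e0.
  have De0 : 0 < up / lo by rewrite divr_gt0.
  pose N := (Num.truncn (ln (up / lo / e) / theta)).+1.
  have [th00 _] := andP th0.
  have NP : ln (up / lo / e) <= theta * N%:R.
    by rewrite -ler_pdivrMl // mulrC ltW // truncnS_gt.
  have small := geometric_small th0 De0 e0 NP.
  exists N; clearbody N => p q.
  pose P (st : ('cV[R]_dy * 'cV[R]_dh) * ('cV[R]_dy * 'cV[R]_dh)) :=
    energy A tau sigma (st.1.1 - st.2.1) (st.1.2 - st.2.2).
  pose f (st : ('cV[R]_dy * 'cV[R]_dh) * ('cV[R]_dy * 'cV[R]_dh)) :=
    (pgd_map F tau sigma x st.1, pgd_map F tau sigma x st.2).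
  have fE n st : iter n f st = (iter n (pgd_map F tau sigma x) st.1,
      iter n (pgd_map F tau sigma x) st.2).
    by elim: n => [|n IH] /=; [case: st|rewrite IH].
  have := @iter_contraction R _ P f theta th1
    (fun st => step F x st.1 st.2 rF) N (dec p, dec q).
  rewrite fE /P /= -!TE /= -!linearB /=.
  set r := iter N T p - iter N T q; set r0 := p - q => H.
  have nE (v : 'cV[R]_(dy + dh)) :
      dot (usubmx v) (usubmx v) + dot (dsubmx v) (dsubmx v) = dot v v.
    by rewrite -dot_col_mx vsubmxK.
  have /andP[+ _] := bnd (usubmx r) (dsubmx r); rewrite nE => low.
  have /andP[_] := bnd (usubmx r0) (dsubmx r0); rewrite nE => high.
  rewrite -(ler_pM2l lo0); apply: (le_trans low); apply: (le_trans H).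
  apply: (@le_trans _ _ ((1 - theta) ^+ N * (up * dot r0 r0))).
    by rewrite ler_wpM2l // exprn_ge0 // subr_ge0.
  rewrite !mulrA ler_wpM2r ?dot_ge0 //.
  move: small; rewrite mulrA ler_pdivrMr //; by rewrite (mulrC e).
exists (usubmx p), (dsubmx p); apply: (pgd_map_kkt t0 s0).
by have := congr1 dec Tp; rewrite /T encK.
Qed.

End Projected_gradient.

(** * The slack-variable primal-dual step at a fixed upper-level point *)

Section Slack_step.
Variables (R : realType) (dx dy dh : nat).
Variables (A : 'M[R]_(dh, dy)) (B : 'M[R]_(dh, dx)) (b : 'cV[R]_dh).
Implicit Types (F : 'cV[R]_(dx + dy) -> R) (x : 'cV[R]_dx) (y z : 'cV[R]_dy).
Implicit Types (u v : 'cV[R]_dh) (w : 'cV[R]_(dy + dh)).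
Implicit Types (s t : 'cV[R]_(dy + dh) * 'cV[R]_dh).

Local Notation h := (constr A B b).
Local Notation kkt := (kkt A B b).

(** The constraint residual [resid] is affine in [y'] with this linear part. *)
Definition slack_mx : 'M[R]_(dh, dy + dh) := row_mx A (- 1%:M).
Local Notation C := slack_mx.

Definition resid x w : 'cV[R]_dh := h x (usubmx w) - dsubmx w.

Lemma slack_mulmx w : C *m w = A *m usubmx w - dsubmx w.
Proof. by rewrite -{1}(vsubmxK w) mul_row_col mulNmx mul1mx. Qed.

Lemma slack_trmx u : C^T *m u = col_mx (A^T *m u) (- u).
Proof. by rewrite tr_row_mx mul_col_mx linearN /= trmx1 mulNmx mul1mx. Qed.

Lemma residB x w w' : resid x w - resid x w' = C *m (w - w').
Proof.
rewrite slack_mulmx usubmxB dsubmxB -(constrBy A B b x) /resid.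
by rewrite !opprD !opprK addrACA.
Qed.

(** With unit penalty, the augmented term is absorbed in the primal gradient,
    which thereby becomes strongly monotone in the slack variables too. *)
Definition slack_grad F x w u : 'cV[R]_(dy + dh) :=
  col_mx (grady F x (usubmx w)) 0 + C^T *m (u + resid x w).

Definition proj_slack w : 'cV[R]_(dy + dh) :=
  col_mx (usubmx w) (negpart (dsubmx w)).

Lemma proj_slackE w : eproj (@Py R dy dh) w = proj_slack w.
Proof. exact/eprojP/proj_Py. Qed.

Lemma usub_proj_slackB w1 w2 w :
  usubmx (proj_slack w1 - proj_slack w2 - w) = usubmx (w1 - w2 - w).
Proof. by rewrite !usubmxB /proj_slack !col_mxKu. Qed.

Definition slack_map F (eta sigma : R) x s :=
  let u' := s.2 + sigma *: resid x s.1 in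
  (proj_slack (s.1 - eta *: slack_grad F x s.1 u'), u').

Definition slack_point x y : 'cV[R]_(dy + dh) := col_mx y (h x y).

Lemma resid_slack_point x y : resid x (slack_point x y) = 0.
Proof. by rewrite /resid /slack_point col_mxKu col_mxKd subrr. Qed.

Lemma kkt_slack_map F eta sigma x y u : 0 < eta -> kkt F x y u ->
  slack_map F eta sigma x (slack_point x y, u) = (slack_point x y, u).
Proof.
move=> e0 [gK uK hK sK].
rewrite /slack_map /slack_grad /= resid_slack_point scaler0 !addr0.
congr pair; rewrite -proj_slackE; apply/eprojP.
have -> : slack_point x y - eta *:
    (col_mx (grady F x (usubmx (slack_point x y))) 0 + C^T *m u)
    = slack_point x y + col_mx 0 (eta *: u).
  rewrite slack_trmx /slack_point col_mxKu add_col_mx gK scale_col_mx add0r.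
  by rewrite scaler0 scalerN opp_col_mx oppr0 opprK.
rewrite /slack_point; apply: proj_Py_fix => i.
- by rewrite col_mxKd.
- by rewrite [X in 0 <= X]mxE mulr_ge0 // ltW.
- by rewrite col_mxKd [X in X * _]mxE -mulrA sK mulr0.
Qed.

Hypothesis fullA : row_free A.

(** The step uses the updated multiplier, which is the case [j = 0] of
    [energy_contraction]. Only the slack block is projected, so the [y] block
    still determines the image of the multiplier under the transpose of [A]. *)
Lemma slack_map_contraction (L mu : R) : 0 <= L -> 0 < mu ->
  exists eta sigma theta lo up : R,
  [/\ [/\ 0 < eta, 0 < sigma, 0 < theta < 1, 0 < lo & 0 < up],
    forall (w : 'cV[R]_(dy + dh)) (u : 'cV[R]_dh),
      lo * (dot w w + dot u u) <= energy C eta sigma w u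
                <= up * (dot w w + dot u u)
  & forall F x s t, regular L mu F ->
    let s' := slack_map F eta sigma x s in
    let t' := slack_map F eta sigma x t in
    energy C eta sigma (s'.1 - t'.1) (s'.2 - t'.2) <=
      (1 - theta) * energy C eta sigma (s.1 - t.1) (s.2 - t.2)].
Proof.
move=> L0 mu0; have [k k0 kP] := row_free_trmx_bound fullA.
have [a a0 aP] := mulmx_bounded A.
have [c c0 cP] := mulmx_bounded C.
have [c' c'0 c'P] := mulmx_bounded C^T.
pose L' : R := L + c' * c.
have L'0 : 0 <= L' by rewrite addr_ge0 // mulr_ge0.
have a20 := sqr_ge0 a.
have den0 : 0 < 1 + 2 * a ^+ 2 + 2 * mu by lra.
(* The squared slack component is at most twice that of [A *m y] plus twice that
   of the residual; [nu] makes both affordable in the monotonicity estimate. *)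
pose nu : R := mu / (1 + 2 * a ^+ 2 + 2 * mu).
have nu0 : 0 < nu by rewrite divr_gt0.
have nuE : nu * (1 + 2 * a ^+ 2) + 2 * (nu * mu) = mu.
  by rewrite /nu; field; apply: lt0r_neq0.
clearbody nu.
have nu1 : 2 * nu <= 1.
  rewrite -(ler_pM2r mu0) mul1r -[leRHS]nuE -mulrA lerDr.
  by rewrite mulr_ge0 ?ltW //; lra.
have nu2 : nu * (1 + 2 * a ^+ 2) <= mu.
  by rewrite -[leRHS]nuE lerDl !mulr_ge0 // ltW.
pose K : R := 2 * k ^+ 2 * (L' ^+ 2 + 1).
have K0 : 0 <= K by rewrite !mulr_ge0 ?addr_ge0 ?sqr_ge0.
have [eta [sigma [theta [lo [up [pos bnd step]]]]]] :=
  energy_contraction C nu0 L'0 K0.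
exists eta, sigma, theta, lo, up; split=> // F x [w u] [w2 u2] rF /=.
have [e0 s0 _ _ _] := pos.
set q := grady F x (usubmx w) - grady F x (usubmx w2).
pose p : 'cV[R]_(dy + dh) := col_mx q 0 + C^T *m (C *m (w - w2)).
set u' := u + sigma *: resid x w; set u2' := u2 + sigma *: resid x w2.
have pE : slack_grad F x w u' - slack_grad F x w2 u2'
    = p + C^T *m (u' - u2').
  rewrite /slack_grad /p /q opprD addrACA opp_col_mx add_col_mx subr0.
  rewrite -mulmxBr [u' + _ - _](_ : _ = C *m (w - w2) + (u' - u2')).
    by rewrite mulmxDr addrA.
  by rewrite opprD addrACA residB addrC.
have qP : enorm q <= L * enorm (usubmx (w - w2)).
  by rewrite usubmxB; exact: grady_lipy rF.
have qw : enorm q <= L * enorm (w - w2).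
  by apply: le_trans qP _; rewrite ler_wpM2l // enorm_usub.
have qE : w - w2 - eta *: (p + C^T *m (u' - u2'))
    = (w - eta *: slack_grad F x w u') - (w2 - eta *: slack_grad F x w2 u2').
  rewrite -pE scalerBr !opprB addrACA [RHS]addrACA.
  by congr (_ + _); rewrite addrC.
apply: (step 0 _ _ p _ _ (u' - u2')).
- by rewrite lexx ler01.
- by rewrite scale0r subr0.
- rewrite qE.
  exact: (proj_firm (proj_Py _) (proj_Py _)).
- have -> // : u - u2 + sigma *: (C *m (w - w2)) = u' - u2'.
  by rewrite -(residB x) scalerBr /u' /u2' opprD addrACA.
- rewrite /p (dotDr (col_mx q 0)).
  have -> : dot (w - w2) (col_mx q 0) = dot (usubmx (w - w2)) q.
    by rewrite -{1}(vsubmxK (w - w2)) dot_col_mx dot0r addr0.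
  have := reg_mono rF x (usubmx w) (usubmx w2); rewrite -/q -usubmxB => mono.
  rewrite [dot _ (C^T *m _)]dotC dot_mulmx trmxK.
  set y := usubmx (w - w2) in mono *; set al := dsubmx (w - w2).
  have Cw := dot_ge0 (C *m (w - w2)).
  have Ay := dot_le (aP y); rewrite exprMn enorm_sq in Ay.
  have alE : dot al al <= 2 * dot (A *m y) (A *m y)
      + 2 * dot (C *m (w - w2)) (C *m (w - w2)).
    have -> : al = A *m y - C *m (w - w2) by rewrite slack_mulmx opprB addrC subrK.
    apply: le_trans (dotD_le2 _ _) _.
    by rewrite lerD2l dotNl dotNr opprK.
  have -> : dot (w - w2) (w - w2) = dot y y + dot al al.
    by rewrite -dot_col_mx vsubmxK.
  have y0 := dot_ge0 y.
  have H1 : nu * dot al al <= nu * (2 * (a ^+ 2 * dot y y)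
      + 2 * dot (C *m (w - w2)) (C *m (w - w2))).
    by rewrite ler_wpM2l ?(ltW nu0) //; lra.
  have H2 : nu * (1 + 2 * a ^+ 2) * dot y y <= mu * dot y y.
    by rewrite ler_wpM2r.
  have H3 : 2 * nu * dot (C *m (w - w2)) (C *m (w - w2)) <=
      1 * dot (C *m (w - w2)) (C *m (w - w2)) by rewrite ler_wpM2r.
  by lra.
- rewrite -(enorm_sq (w - w2)) -exprMn dot_le //.
  apply: le_trans (enormD _ _) _; rewrite enorm_col_mx0 /L' mulrDl lerD //.
  by apply: le_trans (c'P _) _; rewrite -mulrA ler_wpM2l.
set e := _ - (w - w2).
have pn : dot p p <= L' ^+ 2 * dot (w - w2) (w - w2).
  rewrite -(enorm_sq (w - w2)) -exprMn dot_le //.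
  apply: le_trans (enormD _ _) _; rewrite enorm_col_mx0 /L' mulrDl lerD //.
  by apply: le_trans (c'P _) _; rewrite -mulrA ler_wpM2l.
have uE : A^T *m (u' - u2') = - (usubmx (p + eta^-1 *: e)).
  have -> : A^T *m (u' - u2') = usubmx (C^T *m (u' - u2')).
    by rewrite slack_trmx col_mxKu.
  have eE : usubmx e = - (eta *: usubmx (p + C^T *m (u' - u2'))).
    by rewrite /e usub_proj_slackB -qE addrAC subrr sub0r usubmxN usubmxZ.
  rewrite usubmxD usubmxZ eE scalerN scalerA mulVf ?gt_eqF // scale1r.
  by rewrite usubmxD opprB [RHS]addrC addKr.
have vP : dot (u' - u2') (u' - u2') <=
    k ^+ 2 * dot (p + eta^-1 *: e) (p + eta^-1 *: e).
  rewrite -[X in _ * X]enorm_sq -exprMn dot_le // (le_trans (kP _)) //.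
  by rewrite uE enormN ler_wpM2l // enorm_usub.
apply: (le_trans vP).
have := dotD_le2 p (eta^-1 *: e).
have -> : dot (eta^-1 *: e) (eta^-1 *: e) = eta^-1 ^+ 2 * dot e e.
  by rewrite dotZl dotZr mulrA expr2.
move=> H.
have k20 := sqr_ge0 k; have L20 := sqr_ge0 L'.
have ee0 : 0 <= eta^-1 ^+ 2 * dot e e by rewrite mulr_ge0 ?sqr_ge0 ?dot_ge0.
have w0 := dot_ge0 (w - w2).
apply: (@le_trans _ _ (k ^+ 2 * (2 * (L' ^+ 2 * dot (w - w2) (w - w2))
   + 2 * (eta^-1 ^+ 2 * dot e e)))).
  by rewrite ler_wpM2l //; apply: le_trans H _; rewrite lerD2r ler_pM2l.
have -> : K * (dot (w - w2) (w - w2) + eta^-1 ^+ 2 * dot e e) = k ^+ 2 *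
    (2 * ((L' ^+ 2 + 1) * (dot (w - w2) (w - w2) + eta^-1 ^+ 2 * dot e e))).
  by rewrite /K; ring.
rewrite ler_wpM2l //.
have Le : 0 <= L' ^+ 2 * (eta^-1 ^+ 2 * dot e e) by rewrite mulr_ge0.
move: (dot e e) Le w0 ee0 => ee Le w0 ee0; clearbody L'.
by lra.
Qed.

End Slack_step.

(** * Regularity of the penalized objective and the envelope formula *)

Section Penalized_objective.
Variables (R : realType) (dx dy : nat).
Implicit Types (F f g : 'cV[R]_(dx + dy) -> R) (x : 'cV[R]_dx) (y : 'cV[R]_dy).

Lemma le_of_small (a b c : R) : 0 <= c ->
  (forall t, 0 < t <= 1 -> a <= b + t * c) -> a <= b.
Proof.
move=> c0 H; apply/ler_addgt0Pr => e e0.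
have c1 : 0 < c + 1 by lra.
(* A step small enough for [t * c <= e]. *)
pose t : R := Num.min 1 (e / (c + 1)).
have t0 : 0 < t by rewrite lt_min ltr01 divr_gt0.
have t1 : t <= 1 by rewrite ge_min lexx.
have te : t * (c + 1) <= e by rewrite -ler_pdivlMr // ge_min lexx orbT.
by have := H t; rewrite t0 t1 => /(_ isT); lra.
Qed.

(** Moving along the gradient itself by a vanishing step realizes the slope. *)
Lemma grad_le n (F : 'cV[R]_n -> R) (l M : R) p : lipschitz_scalar l F -> 0 <= M ->
  (forall h, `|F (p + h) - F p - dot (grad F p) h| <= M * dot h h) ->
  enorm (grad F p) <= l.
Proof.
move=> [l0 lF] M0 FP; set v := grad F p.
have [/enorm_eq0 ->|v0] := leP (enorm v) 0; first by rewrite enorm0.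
apply: (@le_of_small _ _ (M * enorm v)); first by rewrite mulr_ge0 // ltW.
move=> t /andP[t0 _]; rewrite -(ler_pM2r v0) -(ler_pM2r t0).
have := FP (t *: v); have := lF (p + t *: v) p.
rewrite [p + _ - p]addrC addKr enormZ (gtr0_norm t0) !dotZr !dotZl -/v -enorm_sq.
rewrite !ler_norml => /andP[_ H1] /andP[H2 _].
by move: H1 H2; rewrite expr2; lra.
Qed.

(** Strong convexity at [t *: y1 + (1 - t) *: y2] is compared with the expansion
    at [y2]; after division by [t], the remainder vanishes with [t]. *)
Lemma strongly_convex_first_order (F : 'cV[R]_(dx + dy) -> R) (M mu : R) x y1 y2 :
  0 <= M -> 0 <= mu ->
  (forall p h, `|F (p + h) - F p - dot (grad F p) h| <= M * dot h h) ->
  strongly_convex mu (fun y => F (col_mx x y)) ->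
  F (col_mx x y2) + dot (grady F x y2) (y1 - y2)
    + mu / 2 * dot (y1 - y2) (y1 - y2) <= F (col_mx x y1).
Proof.
move=> M0 mu0 FP cF; set D := dot (y1 - y2) (y1 - y2).
have D0 : 0 <= D by exact: dot_ge0.
apply: (@le_of_small _ _ ((M + mu / 2) * D)).
  by rewrite mulr_ge0 // addr_ge0 // divr_ge0.
move=> t /andP[t0 t1].
have := cF y1 y2 t; rewrite (ltW t0) t1 => /(_ isT).
have -> : t *: y1 + (1 - t) *: y2 = y2 + t *: (y1 - y2).
  by rewrite scalerBl scale1r scalerBr addrCA.
rewrite enorm_sq -/D.
have := FP (col_mx x y2) (col_mx 0 (t *: (y1 - y2))).
rewrite add_col_mx addr0 dot_col_mx dot0l add0r dotZl dotZr -/D.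
rewrite -{1}(vsubmxK (grad F _)) dot_col_mx dot0r add0r dotZr -/(grady F x y2).
rewrite ler_norml => /andP[H1 _] H2; rewrite -(ler_pM2l t0).
by move: H1 H2; lra.
Qed.

(** The bound on [delta] keeps half of the strong convexity of [g]. *)
Lemma regular_penalized f g (lf1 lg1 mug delta : R) :
  continuously_differentiable f -> continuously_differentiable g ->
  lipschitz_vector lf1 (grad f) -> lipschitz_vector lg1 (grad g) ->
  assumption_S3 g mug -> 0 <= delta -> 2 * lf1 * delta <= mug ->
  (forall p, grad (fun p => delta * f p + g p) p = delta *: grad f p + grad g p)
  /\ regular (lg1 + mug) (mug / 2) (fun p => delta * f p + g p).
Proof.
move=> [df _] [dg _] lf lg [mug0 cg] d0 dmu.
have [lf0 lfP] := lf; have [lg0 lgP] := lg.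
have fP p h := qgrad_lipschitz p df lf h.
have gP p h := qgrad_lipschitz p dg lg h.
have ld0 : 0 <= delta * lf1 by rewrite mulr_ge0.
have GE p : grad (fun p => delta * f p + g p) p = delta *: grad f p + grad g p.
  have qf : qgrad f p (grad f p) by exists lf1.
  have qg : qgrad g p (grad g p) by exists lg1.
  by have [] := qgrad_diff (qgradD (qgradZ delta qf) qg).
have gyE x y : grady (fun p => delta * f p + g p) x y
    = delta *: grady f x y + grady g x y.
  by rewrite /grady GE; apply/colP => i; rewrite !mxE.
have foy x y1 y2 : `|f (col_mx x y1) - f (col_mx x y2)
    - dot (grady f x y2) (y1 - y2)| <= lf1 * dot (y1 - y2) (y1 - y2).
  have := fP (col_mx x y2) (col_mx 0 (y1 - y2)).
  rewrite add_col_mx addr0 [y2 + _]addrC subrK dot_col_mx dot0l add0r.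
  by rewrite -{1}(vsubmxK (grad f _)) dot_col_mx dot0r add0r.
split=> //; split.
- move=> p k; rewrite GE dotDl dotZl.
  have -> : delta * f (p + k) + g (p + k) - (delta * f p + g p)
      - (delta * dot (grad f p) k + dot (grad g p) k)
    = delta * (f (p + k) - f p - dot (grad f p) k)
      + (g (p + k) - g p - dot (grad g p) k) by ring.
  apply: le_trans (ler_normD _ _) _; rewrite normrM (ger0_norm d0).
  have := ler_wpM2l d0 (fP p k); have := gP p k; have k0 := dot_ge0 k.
  have : delta * lf1 * dot k k <= mug * dot k k by rewrite ler_wpM2r //; lra.
  by clear - dx dy; lra.
- move=> p q; rewrite !GE opprD addrACA -scalerBr.
  apply: le_trans (enormD _ _) _; rewrite enormZ (ger0_norm d0).
  have := ler_wpM2l d0 (lfP p q); have := lgP p q; have k0 := enorm_ge0 (p - q).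
  have : delta * lf1 * enorm (p - q) <= mug * enorm (p - q).
    by rewrite ler_wpM2r //; lra.
  move: (enorm (grad f p - _)) (enorm (grad g p - _)) (enorm (p - q)).
  by clear - dx dy; move=> r s t; lra.
- move=> x y1 y2; rewrite !gyE opprD addrACA -scalerBr (dotDr (delta *: _)) dotZr.
  have k0 := dot_ge0 (y1 - y2).
  have H1 := strongly_convex_first_order y1 y2 lg0 (ltW mug0) gP (cg x).
  have := strongly_convex_first_order y2 y1 lg0 (ltW mug0) gP (cg x).
  rewrite -[y2 - y1]opprB !(dotNr, dotNl) opprK => H2.
  have H3 : - (lf1 * dot (y1 - y2) (y1 - y2)) <=
      dot (y1 - y2) (grady f x y1 - grady f x y2).
    apply: le_trans (dot_cauchyN _ _); rewrite lerN2.
    rewrite -enorm_sq expr2 mulrA mulrC ler_wpM2r ?enorm_ge0 //.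
    rewrite /grady -dsubmxB; apply: le_trans (enorm_dsub _) _.
    apply: le_trans (lfP _ _) _.
    by rewrite opp_col_mx add_col_mx subrr enorm_0col_mx.
  have := ler_wpM2l d0 H3.
  have : delta * lf1 * dot (y1 - y2) (y1 - y2) <=
      mug / 2 * dot (y1 - y2) (y1 - y2) by rewrite ler_wpM2r //; lra.
  move: H1 H2; rewrite [dot (y1 - y2) (grady g x y1 - _)](dotBr (grady g x y1)).
  rewrite !(dotC (y1 - y2) (grady g _ _)).
  by clear - dx dy; lra.
move=> x y1 y2; rewrite gyE dotDl dotZl.
have k0 := dot_ge0 (y1 - y2).
have H1 := strongly_convex_first_order y1 y2 lg0 (ltW mug0) gP (cg x).
have := foy x y1 y2; rewrite ler_norml => /andP[+ _] => /(ler_wpM2l d0).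
have : delta * lf1 * dot (y1 - y2) (y1 - y2) <=
      mug / 2 * dot (y1 - y2) (y1 - y2) by rewrite ler_wpM2r //; lra.
by move: H1; clear - dx dy; lra.
Qed.

End Penalized_objective.

Section Envelope.
Variables (R : realType) (dx dy dh : nat).
Variables (A : 'M[R]_(dh, dy)) (B : 'M[R]_(dh, dx)) (b : 'cV[R]_dh).
Implicit Types (F : 'cV[R]_(dx + dy) -> R) (x : 'cV[R]_dx) (y : 'cV[R]_dy).
Implicit Types (u : 'cV[R]_dh).

Local Notation h := (constr A B b).
Local Notation kkt := (kkt A B b).

(** The partial gradient of the Lagrangian in the upper-level variable. *)
Definition env_grad F x y u : 'cV[R]_dx := gradx F x y + B^T *m u.

(** The Lagrangian with the multiplier of the new point is tested at the old
    solution; feasibility of the latter makes its constraint term harmless. *)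
Lemma envelope_upper (L mu : R) F x x' y y' u u' : regular L mu F ->
  kkt F x y u -> kkt F x' y' u' ->
  F (col_mx x' y') - F (col_mx x y) <= dot (env_grad F x y u) (x' - x)
    + L * dot (x' - x) (x' - x) + enorm (u' - u) * enorm (B *m (x' - x)).
Proof.
move=> rF K K'; have := kkt_lagrangian y rF K'.
have -> : h x' y = h x y + B *m (x' - x).
  by rewrite -(constrBx A B b _ _ y) [RHS]addrC subrK.
rewrite dotDr.
have := dot_le0 (kkt_dual K') (kkt_primal K).
have := reg_expand rF (col_mx x y) (col_mx (x' - x) 0).
rewrite add_col_mx addr0 [x + _]addrC subrK dot_col_mx dot0l addr0.
rewrite -{1}(vsubmxK (grad F _)) dot_col_mx dot0r addr0 -/(gradx F x y).
rewrite ler_norml => /andP[_ H1] H2 H3.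
have := dot_cauchy (u' - u) (B *m (x' - x)).
rewrite /env_grad (dotDl (gradx _ _ _)) (dot_mulmx B^T) trmxK (dotBl u').
by move: H1 H2 H3; lra.
Qed.

Hypothesis fullA : row_free A.

(** The lower estimate is the upper one with the two points exchanged; the
    gradients at these are close because the solution and its multiplier are
    Lipschitz in the upper-level variable. *)
Lemma envelope (L mu : R) : 0 <= L -> 0 < mu -> exists2 M : R, 0 <= M &
  forall F x x' y y' u u', regular L mu F -> kkt F x y u -> kkt F x' y' u' ->
  `|F (col_mx x' y') - F (col_mx x y) - dot (env_grad F x y u) (x' - x)|
    <= M * dot (x' - x) (x' - x).
Proof.
move=> L0 mu0; have [c c0 cP] := kkt_lipschitz B b fullA L0 mu0.
have [d d0 dP] := mulmx_bounded B.
have [e e0 eP] := mulmx_bounded B^T.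
exists (L + c * d + (L * (1 + c) + e * c)).
  by rewrite !addr_ge0 ?mulr_ge0 ?addr_ge0.
move=> F x x' y y' u u' rF K K'.
have [yP uP] := cP _ _ _ _ _ _ _ rF K' K.
have up := envelope_upper rF K K'.
have := envelope_upper rF K' K.
rewrite -[x - x']opprB !(dotNr, dotNl, mulmxN, enormN) opprK (enorm_subC u) => lo.
have t0 := enorm_ge0 (x' - x).
have ub : enorm (u' - u) * enorm (B *m (x' - x)) <= c * d * dot (x' - x) (x' - x).
  rewrite -enorm_sq expr2 mulrACA ler_pM ?enorm_ge0 //.
have gb : dot (env_grad F x y u - env_grad F x' y' u') (x' - x) <=
    (L * (1 + c) + e * c) * dot (x' - x) (x' - x).
  apply: le_trans (dot_cauchy _ _) _.
  rewrite -enorm_sq expr2 mulrA ler_wpM2r //.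
  rewrite /env_grad opprD addrACA -mulmxBr.
  apply: le_trans (enormD _ _) _; rewrite mulrDl lerD //.
    apply: le_trans (gradx_lip rF _ _ _ _) _; rewrite -mulrA ler_wpM2l //.
    apply: le_trans (enorm_col_mx_le _ _) _.
    by rewrite (enorm_subC x) (enorm_subC y) mulrDl mul1r lerD2l.
  apply: le_trans (eP _) _; rewrite -mulrA ler_wpM2l //.
  by rewrite (enorm_subC u).
have D0 := dot_ge0 (x' - x).
rewrite dotBl in gb.
have Lc : 0 <= (L * (1 + c) + e * c) * dot (x' - x) (x' - x).
  by rewrite mulr_ge0 // addr_ge0 // mulr_ge0 // addr_ge0.
by rewrite ler_norml; apply/andP; split; lra.
Qed.

End Envelope.

(** * The algorithms in terms of the maps studied above *)

Section Identification.
Variables (R : realType) (dx dy dh : nat).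
Variables (A : 'M[R]_(dh, dy)) (B : 'M[R]_(dh, dx)) (b : 'cV[R]_dh).
Implicit Types (F f g : 'cV[R]_(dx + dy) -> R) (x : 'cV[R]_dx).
Implicit Types (y z : 'cV[R]_dy) (u v : 'cV[R]_dh) (w : 'cV[R]_(dy + dh)).

Local Notation h := (constr A B b).
Local Notation kkt := (kkt A B b).
Local Notation resid := (resid A B b).
Local Notation C := (slack_mx A).

Lemma regular_qgrad (L mu : R) F p : 0 <= L -> regular L mu F ->
  qgrad F p (grad F p).
Proof. by move=> L0 rF; exists L => // k; exact: reg_expand rF p k. Qed.

(** Strong convexity gives the uniqueness without which [ystar] could not be
    identified. *)
Lemma ystar_kkt (L mu mug : R) g x y u : 0 <= L -> regular L mu g ->
  assumption_S3 g mug -> kkt g x y u -> ystar g A B b x = y.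
Proof.
move=> L0 rg [mug0 cg] K; apply: argmin_eq.
- exact: kkt_primal K.
- by move=> q fq; exact: kkt_min rg K fq.
move=> q fq gq; apply/eqP; rewrite -subr_eq0; apply/eqP/dot_eq0.
have := strongly_convex_first_order q y L0 (ltW mug0) (reg_expand rg) (cg x).
have -> : grady g x y = - (A^T *m u) by apply/eqP; rewrite -addr_eq0 (kkt_grad K).
rewrite (dotNl (A^T *m u)) (dot_mulmx A^T) trmxK -(constrBy A B b x) dotBr.
rewrite (kkt_dot K) subr0.
have := dot_le0 (kkt_dual K) fq => uq H.
have : mug / 2 * dot (q - y) (q - y) <= 0 by lra.
by rewrite pmulr_rle0 // divr_gt0.
Qed.

Lemma affine_y x y : h x y = A *m y + (B *m x - b).
Proof. by rewrite /constr addrAC addrC. Qed.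

Lemma affine_x x y : h x y = B *m x + (A *m y - b).
Proof. by rewrite /constr addrA. Qed.

Lemma grad_lagrangian_y (L mu : R) g x y v : 0 <= L -> regular L mu g ->
  grad (fun y => lagrangian g A B b x y v) y = grady g x y + A^T *m v.
Proof.
move=> L0 rg; have qg := qgrad_coly (regular_qgrad (col_mx x y) L0 rg).
have qh := qgrad_affine (qgrad_dot v (A *m y + (B *m x - b))).
apply: qgrad_grad; apply: qgrad_eq (qgradD qg qh) => //.
by move=> z; rewrite /lagrangian affine_y.
Qed.

Lemma grad_lagrangian_v g x z v : grad (lagrangian g A B b x z) v = h x z.
Proof.
have q := qgradD (qgrad_cst (g (col_mx x z)) v) (qgrad_dot (h x z) v).
apply: qgrad_grad; apply: qgrad_eq (add0r _) q.
by move=> v'; rewrite /lagrangian dotC.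
Qed.

(** Two multipliers have the same image under the transpose of [A], which is
    injective. *)
Lemma vstar_kkt (L mu mug : R) g x y u : 0 <= L -> row_free A ->
  regular L mu g -> assumption_S3 g mug -> kkt g x y u ->
  vstar g A B b x = u.
Proof.
move=> L0 fA rg sg K; have yE := ystar_kkt L0 rg sg K.
rewrite /vstar; case: xgetP => [v _ [_]|/(_ u) []].
  rewrite (grad_lagrangian_y _ _ _ L0 rg) yE => gv _.
  have [c c0 cP] := row_free_trmx_bound fA.
  apply/eqP; rewrite -subr_eq0; apply/eqP/enorm_eq0; apply: le_trans (cP _) _.
  have -> : A^T *m (v - u) = 0.
    rewrite mulmxBr; apply/eqP; rewrite subr_eq0 -(inj_eq (addrI (grady g x y))).
    by rewrite gv (kkt_grad K).
  by rewrite enorm0 mulr0.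
have [gK uK hK sK] := K.
split; first exact: uK.
  by rewrite (grad_lagrangian_y _ _ _ L0 rg) yE.
by rewrite yE.
Qed.

Lemma pgd_stepE (L mu tau sigma : R) g x s : 0 <= L -> regular L mu g ->
  pgd_step g A B b tau sigma x s = pgd_map A B b g tau sigma x s.
Proof.
move=> L0 rg; case: s => z v; rewrite /pgd_step /pgd_map /=.
by rewrite (grad_lagrangian_y _ _ _ L0 rg) grad_lagrangian_v (eprojP (proj_nonneg _)).
Qed.

(** [Kfun] is a difference of two such functions in separate variables, one for
    [delta f + g] and one for [g] ([KfunE]): the algorithm thus runs the same
    primal-dual step on two independent lower-level problems, coupled only
    through [x]. *)
Definition augmented F x w u : R :=
  F (col_mx x (usubmx w)) + dot u (resid x w) + 1 / 2 * enorm (resid x w) ^+ 2.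

Definition xdir F x w u : 'cV[R]_dx :=
  gradx F x (usubmx w) + B^T *m (u + resid x w).

Lemma qgrad_penalty m n (M : 'M[R]_(m, n)) (c u : 'cV[R]_m) (p : 'cV[R]_n) :
  qgrad (fun q => dot u (M *m q + c) + 1 / 2 * enorm (M *m q + c) ^+ 2) p
    (M^T *m (u + (M *m p + c))).
Proof.
have q1 := qgrad_affine (qgrad_dot u (M *m p + c)).
have q2 := qgradZ (1 / 2) (qgrad_affine (qgrad_sqnorm (M *m p + c))).
apply: qgrad_eq (qgradD q1 q2) => //.
rewrite -scalemxAr scalerA mul1r mulVf ?pnatr_eq0 // scale1r.
by rewrite -mulmxDr.
Qed.

Lemma qgrad_augmented_x (L mu : R) F x w u : 0 <= L -> regular L mu F ->
  qgrad (fun x => augmented F x w u) x (xdir F x w u).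
Proof.
move=> L0 rF.
have qF := qgrad_colx (regular_qgrad (col_mx x (usubmx w)) L0 rF).
have rE x' : resid x' w = B *m x' + (A *m usubmx w - b - dsubmx w).
  by rewrite /resid affine_x -addrA.
apply: qgrad_eq (qgradD qF (qgrad_penalty B (A *m usubmx w - b - dsubmx w) u x)).
  by move=> x'; rewrite /augmented rE addrA.
by rewrite /xdir rE.
Qed.

Lemma qgrad_augmented_w (L mu : R) F x w u : 0 <= L -> regular L mu F ->
  qgrad (fun w => augmented F x w u) w (slack_grad A B b F x w u).
Proof.
move=> L0 rF.
have [M M0 FP] := qgrad_coly (regular_qgrad (col_mx x (usubmx w)) L0 rF).
have qF : qgrad (fun w => F (col_mx x (usubmx w))) w
    (col_mx (grady F x (usubmx w)) 0).
  exists M => // k; rewrite usubmxD.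
  apply: le_trans (_ : _ <= M * dot (usubmx k) (usubmx k)) _.
    rewrite -{2}(vsubmxK k) dot_col_mx dot0l addr0; exact: FP.
  by rewrite ler_wpM2l // -!enorm_sq; rewrite enorm_sq; exact/dot_le/enorm_usub.
have rE w' : resid x w' = C *m w' + (B *m x - b).
  by rewrite /resid affine_y slack_mulmx addrAC.
apply: qgrad_eq (qgradD qF (qgrad_penalty C (B *m x - b) u w)).
  by move=> w'; rewrite /augmented rE addrA.
by rewrite /slack_grad rE.
Qed.

Lemma KfunE f g delta x w (z : 'cV[R]_(dy + dh)) u v :
  Kfun f g A B b delta 1 1 x w z u v =
  augmented (fun p => delta * f p + g p) x w u - augmented g x z v.
Proof. by rewrite /Kfun /augmented /resid /=; ring. Qed.

Lemma sflcb_stepE (L mu : R) f g delta eta_x eta sigma x w (z : 'cV[R]_(dy + dh)) u v :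
  let G := fun p => delta * f p + g p in
  0 <= L -> regular L mu G -> regular L mu g ->
  sflcb_step f g A B b delta 1 1 eta_x eta eta sigma sigma
    (SflcbState x w z u v) =
  let s := slack_map A B b G eta sigma x (w, u) in
  let t := slack_map A B b g eta sigma x (z, v) in
  SflcbState (x - eta_x *: (xdir G x w s.2 - xdir g x z t.2)) s.1 t.1 s.2 t.2.
Proof.
move=> G L0 rG rg; rewrite /sflcb_step /slack_map /=.
rewrite -!/(resid _ _) !proj_slackE.
set u1 := u + _; set v1 := v + _.
have KE x' w' (z' : 'cV[R]_(dy + dh)) : Kfun f g A B b delta 1 1 x' w' z' u1 v1 =
  augmented G x' w' u1 - augmented g x' z' v1 by rewrite KfunE.
rewrite (qgrad_grad (qgrad_eq (fun x' => esym (KE x' w z)) erefl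
  (qgradB (qgrad_augmented_x x w u1 L0 rG) (qgrad_augmented_x x z v1 L0 rg)))).
rewrite (qgrad_grad (qgrad_eq (fun w' => esym (KE x w' z)) (subr0 _)
  (qgradB (qgrad_augmented_w x w u1 L0 rG) (qgrad_cst (augmented g x z v1) w)))).
rewrite (qgrad_grad (qgrad_eq (fun z' : 'cV[R]_(dy + dh) => esym (KE x w z')) (sub0r _)
  (qgradB (qgrad_cst (augmented G x w u1) z) (qgrad_augmented_w x z v1 L0 rg)))).
by rewrite scalerN.
Qed.

Lemma sup_max (S : set R) m : S m -> ubound S m -> sup S = m.
Proof.
move=> Sm ubm; apply/le_anti/andP; split.
  by apply: ge_sup => //; exists m.
by apply: ub_le_sup => //; exists m.
Qed.

Lemma inf_min (S : set R) m : S m -> lbound S m -> inf S = m.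
Proof.
move=> Sm lbm; apply/le_anti/andP; split.
  by apply: ge_inf => //; exists m.
by apply: lb_le_inf => //; exists m.
Qed.

(** The inner supremum is attained at the minimizer of [g], which does not depend
    on [y], so the penalized value is a difference of two optimal values. *)
Lemma Phi_penE (L mu : R) f g delta x y z u v :
  let G := fun p => delta * f p + g p in
  0 < delta -> regular L mu G -> regular L mu g ->
  kkt G x y u -> kkt g x z v ->
  Phi_pen f g A B b delta x = delta^-1 * (G (col_mx x y) - g (col_mx x z)).
Proof.
move=> G d0 rG rg KG Kg; have d1 : 0 < delta^-1 by rewrite invr_gt0.
have GE y' : f (col_mx x y') + delta^-1 * (g (col_mx x y') - g (col_mx x z))
    = delta^-1 * (G (col_mx x y') - g (col_mx x z)).
  by rewrite /G; field; rewrite gt_eqF.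
have supE y' : sup [set f (col_mx x y')
      + delta^-1 * (g (col_mx x y') - g (col_mx x z')) | z' in feasible A B b x]
    = delta^-1 * (G (col_mx x y') - g (col_mx x z)).
  apply: sup_max.
    by exists z; [exact: kkt_primal Kg|exact: GE].
  move=> _ [z' fz' <-]; rewrite -GE lerD2l ler_pM2l // lerD2l lerN2.
  exact: kkt_min rg Kg fz'.
apply: inf_min; first by exists y; [exact: kkt_primal KG|exact: supE].
move=> _ [y' fy' <-]; rewrite supE ler_pM2l // lerD2r.
exact: kkt_min rG KG fy'.
Qed.

End Identification.

(** * Descent of the upper-level variable *)

Section Descent.
Variables (R : realType) (dx dy dh : nat).
Variables (A : 'M[R]_(dh, dy)) (B : 'M[R]_(dh, dx)) (b : 'cV[R]_dh).
Implicit Types (F G g : 'cV[R]_(dx + dy) -> R) (x : 'cV[R]_dx).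
Implicit Types (y : 'cV[R]_dy) (u v : 'cV[R]_dh) (w z : 'cV[R]_(dy + dh)).

Local Notation h := (constr A B b).
Local Notation kkt := (kkt A B b).
Local Notation resid := (resid A B b).
Local Notation slack_point := (slack_point A B b).
Local Notation slack_map := (slack_map A B b).
Local Notation xdir := (xdir A B b).
Local Notation env_grad := (env_grad B).
Local Notation C := (slack_mx A).

Lemma exists_step (theta M Q k : R) : 0 < theta -> 0 <= M -> 0 <= Q -> 0 <= k ->
  exists2 t : R, 0 < t & t * (M + Q) <= 1 / 2 /\ t * k <= theta / 2.
Proof.
move=> th0 M0 Q0 k0; pose q : R := 2 * (M + Q) + 2 * k / theta + 1.
have kt0 : 0 <= 2 * k / theta by rewrite divr_ge0 ?(ltW th0) // mulr_ge0.
have q0 : 0 < q by rewrite /q; lra.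
exists q^-1; first by rewrite invr_gt0.
rewrite ![q^-1 * _]mulrC !ler_pdivrMr //; split; first by rewrite /q; lra.
have -> : theta / 2 * q = theta / 2 * (2 * (M + Q) + 1) + k.
  by rewrite /q; field; rewrite gt_eqF.
by rewrite lerDr mulr_ge0 ?divr_ge0 ?(ltW th0) //; lra.
Qed.

(** At the exact inner solution the residual is zero and [xdir] is [env_grad]. *)
Lemma xdir_error (L mu sigma : R) : 0 <= L -> exists2 k : R, 0 <= k &
  forall F x w y u u0, regular L mu F ->
  let e := xdir F x w (u + sigma *: resid x w) - env_grad F x y u0 in
  let w0 := slack_point x y in
  dot e e <= k * (dot (w - w0) (w - w0) + dot (u - u0) (u - u0)).
Proof.
move=> L0; have [c c0 cP] := mulmx_bounded C; have [d d0 dP] := mulmx_bounded B^T.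
pose a : R := L + d * (`|sigma + 1| * c).
have a0 : 0 <= a by rewrite addr_ge0 // !mulr_ge0.
exists (2 * a ^+ 2 + 2 * d ^+ 2).
  by rewrite addr_ge0 // mulr_ge0 // sqr_ge0.
move=> F x w y u u0 rF /=; set w0 := slack_point x y.
have rE : resid x w = C *m (w - w0).
  by rewrite -(residB A B b x) resid_slack_point subr0.
set e := _ - env_grad _ _ _ _.
have eP : enorm e <= a * enorm (w - w0) + d * enorm (u - u0).
  have -> : e = (gradx F x (usubmx w) - gradx F x y)
      + B^T *m ((u - u0) + (sigma + 1) *: (C *m (w - w0))).
    rewrite /e /xdir /env_grad opprD addrACA -mulmxBr rE scalerDl scale1r.
    by rewrite -!addrA [- u0 + _]addrC !addrA.
  apply: le_trans (enormD _ _) _; rewrite /a mulrDl -[leRHS]addrA lerD //.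
    apply: le_trans (gradx_lip rF _ _ _ _) _; rewrite subrr enorm_0col_mx.
    rewrite ler_wpM2l // -[y](col_mxKu y (h x y)) -usubmxB.
    exact: enorm_usub.
  apply: le_trans (dP _) _; rewrite -mulrA -mulrDr ler_wpM2l //.
  apply: le_trans (enormD _ _) _; rewrite [leRHS]addrC lerD2l enormZ -mulrA.
  by rewrite ler_wpM2l.
rewrite -!enorm_sq; have e0 := enorm_ge0 e.
have p0 := enorm_ge0 (w - w0); have q0 := enorm_ge0 (u - u0).
move: (enorm e) (enorm (w - w0)) (enorm (u - u0)) eP e0 p0 q0 => s p q sP s0 p0 q0.
have sq : s ^+ 2 <= (a * p + d * q) ^+ 2.
  by rewrite ler_sqr // nnegrE addr_ge0 ?mulr_ge0.
apply: le_trans sq _.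
have := sqr_ge0 (a * p - d * q); have := sqr_ge0 (a * q); have := sqr_ge0 (d * p).
by clear - A B b; lra.
Qed.

Hypothesis fullA : row_free A.

Lemma slack_point_lipschitz (L mu : R) : 0 <= L -> 0 < mu ->
  exists2 k : R, 0 <= k & forall F x x' y y' u u', regular L mu F ->
  kkt F x y u -> kkt F x' y' u' ->
  let w := slack_point x y in let w' := slack_point x' y' in
  dot (w - w') (w - w') + dot (u - u') (u - u') <= k * dot (x - x') (x - x').
Proof.
move=> L0 mu0; have [c c0 cP] := kkt_lipschitz B b fullA L0 mu0.
have [a a0 aP] := mulmx_bounded A; have [d d0 dP] := mulmx_bounded B.
exists ((c + (a * c + d)) ^+ 2 + c ^+ 2); first by rewrite addr_ge0 ?sqr_ge0.
move=> F x x' y y' u u' rF K K' /=.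
have [yP uP] := cP _ _ _ _ _ _ _ rF K K'.
rewrite mulrDl -(enorm_sq (x - x')) -!exprMn lerD //; last exact: dot_le.
apply: dot_le; rewrite opp_col_mx add_col_mx.
apply: le_trans (enorm_col_mx_le _ _) _; rewrite mulrDl lerD //.
have -> : h x y - h x' y' = A *m (y - y') + B *m (x - x').
  rewrite -(constrBy A B b x') -(constrBx A B b _ _ y).
  by rewrite [RHS]addrC addrA subrK.
apply: le_trans (enormD _ _) _; rewrite mulrDl lerD //.
by apply: le_trans (aP _) _; rewrite -mulrA ler_wpM2l.
Qed.

(** In the potential [V], the contraction of the inner energies pays for the
    drift of the inner solutions, caused by the move of [x], and for the error
    of the upper-level direction, once [eta_x] is small. *)
Lemma sflcb_descent (L mu : R) : 0 <= L -> 0 < mu ->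
  exists eta sigma eta_x up : R,
  [/\ [/\ 0 < eta, 0 < sigma, 0 < eta_x & 0 < up],
    forall w u, 0 <= energy C eta sigma w u <= up * (dot w w + dot u u)
  & forall G g (yG yg : 'cV[R]_dx -> 'cV[R]_dy) (uG ug : 'cV[R]_dx -> 'cV[R]_dh),
    regular L mu G -> regular L mu g ->
    (forall x, kkt G x (yG x) (uG x)) -> (forall x, kkt g x (yg x) (ug x)) ->
    let Psi x := G (col_mx x (yG x)) - g (col_mx x (yg x)) in
    let dPsi x := env_grad G x (yG x) (uG x) - env_grad g x (yg x) (ug x) in
    let V x w z u v := Psi x
      + energy C eta sigma (w - slack_point x (yG x)) (u - uG x)
      + energy C eta sigma (z - slack_point x (yg x)) (v - ug x) in
    (forall x, qgrad Psi x (dPsi x)) /\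
    forall x w z u v,
    let s := slack_map G eta sigma x (w, u) in
    let t := slack_map g eta sigma x (z, v) in
    let x' := x - eta_x *: (xdir G x w s.2 - xdir g x z t.2) in
    V x' s.1 t.1 s.2 t.2 <= V x w z u v - eta_x / 2 * dot (dPsi x) (dPsi x)].
Proof.
move=> L0 mu0.
have [eta [sigma [theta [lo [up [[e0 s0 th0 lo0 up0] bnd step]]]]]] :=
  slack_map_contraction B b fullA L0 mu0.
have [M M0 MP] := envelope B b fullA L0 mu0.
have [k k0 kP] := xdir_error mu sigma L0.
have [l l0 lP] := slack_point_lipschitz L0 mu0.
have [th00 th01] := andP th0.
have th2 : 0 < theta / 2 by rewrite divr_gt0.
pose Q : R := (1 + (theta / 2)^-1) * (up * l).
have Q0 : 0 <= Q.
  by rewrite !mulr_ge0 ?addr_ge0 ?invr_ge0 // ltW.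
have klo : 0 <= k / lo by rewrite divr_ge0 // ltW.
(* [M] bounds the curvature of [Psi] and [Q] the drift of the inner solutions,
   once for each of the two lower-level problems; [k / lo] compares the error
   of the direction with the energies. *)
have [eta_x ex0 [exM exk]] := exists_step th00
  (mulr_ge0 (ler0n R 2) M0) (mulr_ge0 (ler0n R 2) Q0) klo.
have energy0 w u : 0 <= energy C eta sigma w u.
  apply: le_trans (proj1 (andP (bnd w u))).
  by rewrite mulr_ge0 ?(ltW lo0) // addr_ge0 ?dot_ge0.
exists eta, sigma, eta_x, up; split=> //.
  by move=> w u; rewrite energy0 /=; case/andP: (bnd w u).
move=> G g yG yg uG ug rG rg KG Kg Psi dPsi V.
have PsiP x x' : `|Psi x' - Psi x - dot (dPsi x) (x' - x)|
    <= 2 * M * dot (x' - x) (x' - x).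
  have HG := MP _ _ _ _ _ _ _ rG (KG x) (KG x').
  have Hg := MP _ _ _ _ _ _ _ rg (Kg x) (Kg x').
  move: HG Hg; rewrite /dPsi (dotBl (env_grad G _ _ _)) /Psi !ler_norml.
  move=> /andP[H1 H2] /andP[H3 H4].
  by apply/andP; split; move: H1 H2 H3 H4; clear - A B b fullA; lra.
split.
  move=> x; exists (2 * M) => [|d]; first by rewrite mulr_ge0.
  by have := PsiP x (x + d); rewrite [x + d - x]addrC addKr.
move=> x w z u v.
pose s := slack_map G eta sigma x (w, u); pose t := slack_map g eta sigma x (z, v).
pose d : 'cV[R]_dx := xdir G x w s.2 - xdir g x z t.2.
pose x' := x - eta_x *: d.
suff : V x' s.1 t.1 s.2 t.2 <= V x w z u v - eta_x / 2 * dot (dPsi x) (dPsi x).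
  by [].
have dxE : x' - x = - (eta_x *: d) by rewrite /x' addrAC subrr sub0r.
have track F w1 u1 y1 y2 v1 v2 s1 : s1 = slack_map F eta sigma x (w1, u1) ->
    regular L mu F ->
    kkt F x y1 v1 -> kkt F x' y2 v2 ->
    energy C eta sigma (s1.1 - slack_point x' y2) (s1.2 - v2) <=
    (1 - theta / 2) * energy C eta sigma (w1 - slack_point x y1) (u1 - v1)
      + Q * (eta_x ^+ 2 * dot d d).
  move=> s1E rF K1 K2.
  have := step F x (w1, u1) (slack_point x y1, v1) rF.
  rewrite (kkt_slack_map _ e0 K1) -s1E => H.
  have -> : s1.1 - slack_point x' y2 = (s1.1 - slack_point x y1)
      + (slack_point x y1 - slack_point x' y2) by rewrite addrA subrK.
  have -> : s1.2 - v2 = (s1.2 - v1) + (v1 - v2) by rewrite addrA subrK.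
  apply: le_trans (energyD_le _ _ _ _ th2 energy0) _; apply: lerD.
    apply: (@le_trans _ _ ((1 + theta / 2) * ((1 - theta) *
        energy C eta sigma (w1 - slack_point x y1) (u1 - v1)))).
      by rewrite ler_pM2l //; move: th00; clear - A B b fullA; lra.
    rewrite mulrA ler_wpM2r //.
    by have := sqr_ge0 theta; move: th00; clear - A B b fullA; nra.
  rewrite /Q -[leRHS]mulrA ler_wpM2l ?addr_ge0 ?invr_ge0 ?(ltW th2) //.
  apply: le_trans (proj2 (andP (bnd _ _))) _.
  rewrite -[leRHS]mulrA ler_pM2l //; apply: le_trans (lP _ _ _ _ _ _ _ rF K1 K2) _.
  rewrite ler_wpM2l // -[x - x']opprB dxE opprK dotZl dotZr.
  by rewrite mulrA expr2.
have HG := track _ w u _ _ _ _ s erefl rG (KG x) (KG x').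
have Hg := track _ z v _ _ _ _ t erefl rg (Kg x) (Kg x').
have eG := kP G x w (yG x) u (uG x) rG.
have eg := kP g x z (yg x) v (ug x) rg.
have dE : d - dPsi x = (xdir G x w s.2 - env_grad G x (yG x) (uG x))
    + - (xdir g x z t.2 - env_grad g x (yg x) (ug x)).
  by rewrite /d /dPsi !opprB addrACA [RHS]addrACA; congr (_ + _); rewrite addrC.
set EG := energy C eta sigma (w - _) _ in HG *.
set Eg := energy C eta sigma (z - _) _ in Hg *.
have err : dot (d - dPsi x) (d - dPsi x) <= 2 * (k / lo * (EG + Eg)).
  rewrite dE; apply: le_trans (dotD_le2 _ _) _.
  rewrite [X in _ + 2 * X](_ : _ = dot (xdir g x z t.2 - env_grad g x (yg x) (ug x))
    (xdir g x z t.2 - env_grad g x (yg x) (ug x))); last by rewrite dotNl dotNr opprK.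
  rewrite -mulrDr ler_pM2l // mulrDr lerD //.
    apply: (le_trans eG); rewrite -mulrA ler_wpM2l // mulrC ler_pdivlMr //.
    by rewrite mulrC; case/andP: (bnd (w - slack_point x (yG x)) (u - uG x)).
  apply: (le_trans eg); rewrite -mulrA ler_wpM2l // mulrC ler_pdivlMr //.
  by rewrite mulrC; case/andP: (bnd (z - slack_point x (yg x)) (v - ug x)).
have := PsiP x x'; rewrite dxE dotNl !dotNr opprK !dotZr dotZl ler_norml.
move=> /andP[_ HPsi].
have E0 : 0 <= EG + Eg by apply: addr_ge0; exact: energy0.
have D0 := dot_ge0 d.
(* Polarization turns the scalar product of the gradient with the direction
   into a decrease by half of both squared norms, up to the error. *)
have errE : dot (d - dPsi x) (d - dPsi x) =
    dot d d + dot (dPsi x) (dPsi x) - 2 * dot (dPsi x) d.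
  by rewrite (dotBl d) !(dotBr d) (dotC d (dPsi x)); ring.
rewrite errE in err.
have c1 : eta_x * (eta_x * (2 * M + 2 * Q) * dot d d) <= eta_x * (1 / 2 * dot d d).
  by rewrite ler_pM2l // ler_wpM2r.
have c2 : eta_x * (k / lo) * (EG + Eg) <= theta / 2 * (EG + Eg).
  by rewrite ler_wpM2r.
have {}err := ler_wpM2l (ltW ex0) err.
rewrite /V -/EG -/Eg.
move: HG Hg HPsi c1 c2 err.
move: (energy _ _ _ _ _) (energy _ _ _ _ _) (Psi x') (Psi x) => E1 E2 P1 P0.
move: (k / lo) (dot d d) (dot (dPsi x) _) (dot _ _).
by clear - A B b fullA; move=> *; lra.
Qed.

End Descent.

(** * Iteration counts *)

Section Rates.
Variable R : realType.

Lemma bigO_right0 (F G : R -> R) (K r : R) : 0 < r ->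
  (forall eps, 0 < eps < r -> `|F eps| <= K * `|G eps|) ->
  (F : R -> R^o) =O_ (0^'+) (G : R -> R^o).
Proof.
move=> r0 FG; apply/eqO_exP; exists (Num.max K 1); first by rewrite lt_max ltr01 orbT.
near=> eps; apply: (@le_trans _ _ (K * `|G eps|)).
  by apply: FG; apply/andP; split; near: eps; [exact: nbhs_right_gt|exact: nbhs_right_lt].
by rewrite ler_wpM2r // le_max lexx.
Unshelve. all: by end_near. Qed.

Lemma ln_inv_bounds (eps : R) : 0 < eps < expR (- 1) ->
  1 <= ln eps^-1 /\ ln eps^-1 <= eps ^- 3.
Proof.
move=> /andP[e0 e1]; have i0 : 0 < eps^-1 by rewrite invr_gt0.
split.
  rewrite -[leLHS]expRK ler_ln ?posrE ?expR_gt0 //.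
  by rewrite -[leLHS]invrK -expRN lef_pV2 ?posrE ?expR_gt0 // ltW.
have eps1 : eps <= 1.
  by apply: le_trans (ltW e1) _; rewrite expR_le1 oppr_le0.
apply: (@le_trans _ _ eps^-1).
  have := expR_ge1Dx (ln eps^-1); rewrite lnK ?posrE //; lra.
rewrite lef_pV2 ?posrE ?exprn_gt0 // exprS ler_piMr ?(ltW e0) //.
by rewrite exprn_ile1 // ltW.
Qed.

(** Below [expR (- 1)] one has [1 <= ln eps^-1 <= eps ^- 3], so the cubic count
    dominates the logarithmic one. *)
Lemma complexity_bigO (Na Nb : R -> nat) (Ka Kb : R) :
  (forall eps, 0 < eps < expR (- 1) -> (Na eps)%:R <= Ka * ln eps^-1) ->
  (forall eps, 0 < eps < expR (- 1) -> (Nb eps)%:R <= Kb * eps ^- 3) ->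
  [/\ (fun eps : R => (Na eps)%:R : R^o) =O_ (0^'+)
        (fun eps : R => ln (eps^-1) : R^o),
      (fun eps : R => (Nb eps)%:R : R^o) =O_ (0^'+)
        (fun eps : R => eps ^- 3 : R^o),
      (fun eps : R => (Na eps + Nb eps)%:R : R^o) =O_ (0^'+)
        (fun eps : R => eps ^- 3 + ln (eps^-1) : R^o)
    & (fun eps : R => (Na eps + Nb eps)%:R : R^o) =O_ (0^'+)
        (fun eps : R => eps ^- 3 : R^o)].
Proof.
move=> HA HB; have r0 : (0 : R) < expR (- 1) by exact: expR_gt0.
pose K := `|Ka| + `|Kb|.
have bnd eps : 0 < eps < expR (- 1) -> [/\ 0 <= ln eps^-1, 0 <= eps ^- 3,
    (Na eps)%:R <= `|Ka| * ln eps^-1, (Nb eps)%:R <= `|Kb| * eps ^- 3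
  & (Na eps + Nb eps)%:R <= K * eps ^- 3].
  move=> e; have [l1 l3] := ln_inv_bounds e.
  have l0 : 0 <= ln eps^-1 by lra.
  have c0 : 0 <= eps ^- 3 by lra.
  have Ha : (Na eps)%:R <= `|Ka| * ln eps^-1.
    by apply: le_trans (HA _ e) _; rewrite ler_wpM2r // ler_norm.
  have Hb : (Nb eps)%:R <= `|Kb| * eps ^- 3.
    by apply: le_trans (HB _ e) _; rewrite ler_wpM2r // ler_norm.
  split=> //; rewrite natrD /K mulrDl lerD //.
  by apply: le_trans Ha _; rewrite ler_wpM2l.
split.
- apply: (@bigO_right0 _ _ `|Ka| _ r0) => eps /bnd[l0 c0 Ha Hb H].
  by rewrite (ger0_norm (ler0n _ _)) (ger0_norm l0).
- apply: (@bigO_right0 _ _ `|Kb| _ r0) => eps /bnd[l0 c0 Ha Hb H].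
  by rewrite (ger0_norm (ler0n _ _)) (ger0_norm c0).
- apply: (@bigO_right0 _ _ K _ r0) => eps /bnd[l0 c0 Ha Hb H].
  rewrite (ger0_norm (ler0n _ _)) (ger0_norm (addr_ge0 c0 l0)).
  by apply: (le_trans H); rewrite ler_wpM2l ?addr_ge0 // lerDl.
- apply: (@bigO_right0 _ _ K _ r0) => eps /bnd[l0 c0 Ha Hb H].
  by rewrite (ger0_norm (ler0n _ _)) (ger0_norm c0).
Qed.

(** The square in the target precision only doubles the logarithm. *)
Lemma geometric_count (theta D c : R) : 0 < theta < 1 -> 0 < D -> 0 < c ->
  exists (N : R -> nat) (K : R),
  (forall eps, 0 < eps < expR (- 1) -> (N eps)%:R <= K * ln eps^-1) /\
  forall eps, 0 < eps -> (1 - theta) ^+ (N eps) * D <= (c * eps) ^+ 2.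
Proof.
move=> th D0 c0; have /andP[th0 th1] := th.
pose T eps : R := `|ln (D / (c * eps) ^+ 2)| / theta.
exists (fun eps => (Num.truncn (T eps)).+1).
exists ((`|ln (D / c ^+ 2)| + 2) / theta + 1); split=> eps; last first.
  move=> e0; have ce0 : 0 < (c * eps) ^+ 2 by rewrite exprn_gt0 // mulr_gt0.
  apply: (geometric_small th D0 ce0); rewrite -ler_pdivrMl // mulrC.
  apply: (@le_trans _ _ (T eps)); last by rewrite ltW // truncnS_gt.
  by rewrite /T ler_pM2r ?invr_gt0 // ler_norm.
move=> e; have [l1 _] := ln_inv_bounds e; have /andP[e0 _] := e.
have T0 : 0 <= T eps by rewrite /T divr_ge0 // ltW.
rewrite -natr1 mulrDl mul1r lerD //.
apply: (@le_trans _ _ (T eps)).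
  by have /andP[] := truncn_itv T0.
rewrite /T mulrAC ler_pM2r ?invr_gt0 //.
have -> : D / (c * eps) ^+ 2 = D / c ^+ 2 * (eps^-1 * eps^-1).
  by field; rewrite !gt_eqF.
have i0 : 0 < eps^-1 by rewrite invr_gt0.
have Dc0 : 0 < D / c ^+ 2 by rewrite divr_gt0 // exprn_gt0.
have lnMp x y : 0 < x -> 0 < y -> ln (x * y) = ln x + ln y :> R.
  by move=> x0 y0; rewrite lnM ?posrE.
rewrite (lnMp _ _ Dc0 (mulr_gt0 i0 i0)) (lnMp _ _ i0 i0).
apply: le_trans (ler_normD _ _) _; rewrite mulrDl lerD //.
  by rewrite ler_peMr.
by rewrite ger0_norm; move: l1; clear; lra.
Qed.

Lemma polynomial_count (a k : R) : 0 <= a -> 0 <= k ->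
  exists (N : R -> nat) (K : R),
  (forall eps, 0 < eps < expR (- 1) -> (N eps)%:R <= K * eps ^- 3) /\
  forall eps, 0 < eps -> (a / eps + k) / eps ^+ 2 <= (N eps)%:R.
Proof.
move=> a0 k0; pose T eps : R := (a / eps + k) / eps ^+ 2.
exists (fun eps => (Num.truncn (T eps)).+1), (a + k + 1); split=> eps.
  move=> e; have [l1 l3] := ln_inv_bounds e; have /andP[e0 e1] := e.
  have eps1 : eps <= 1.
    by apply: le_trans (ltW e1) _; rewrite expR_le1 oppr_le0.
  have T0 : 0 <= T eps.
    by rewrite /T divr_ge0 ?sqr_ge0 // addr_ge0 // divr_ge0 // ltW.
  rewrite -natr1 mulrDl mul1r lerD //; last by apply: le_trans l3.
  apply: (@le_trans _ _ (T eps)); first by have /andP[] := truncn_itv T0.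
  have -> : T eps = (a + k * eps) * eps ^- 3 by rewrite /T; field; rewrite gt_eqF.
  rewrite ler_wpM2r ?invr_ge0 ?exprn_ge0 ?(ltW e0) // lerD2l ler_piMr //.
by move=> _; rewrite ltW // truncnS_gt.
Qed.

End Rates.

(** * Complexity of the two phases *)

Section Complexity.
Variables (R : realType) (dx dy dh : nat).
Variables (f g : 'cV[R]_(dx + dy) -> R).
Variables (A : 'M[R]_(dh, dy)) (B : 'M[R]_(dh, dx)) (b : 'cV[R]_dh).
Variables (lf0 lf1 lg1 mug c1 : R) (x0 : 'cV[R]_dx).
Hypothesis Cf : continuously_differentiable f.
Hypothesis Cg : continuously_differentiable g.
Hypothesis fullA : row_free A.
Hypothesis S1 : assumption_S1 f g A B b.
Hypothesis S2 : assumption_S2 f g lf0 lf1 lg1.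
Hypothesis S3 : assumption_S3 g mug.
Hypothesis c1_gt0 : 0 < c1.

Let L : R := lg1 + mug.
Let mu : R := mug / 2.

Let mug0 : 0 < mug. Proof. by case: S3. Qed.
Let mu0 : 0 < mu. Proof. by rewrite /mu divr_gt0. Qed.
Let lg0 : 0 <= lg1. Proof. by case: S2 => _ _ []. Qed.
Let lf10 : 0 <= lf1. Proof. by case: S2 => _ []. Qed.
Let lf00 : 0 <= lf0. Proof. by case: S2 => [[]]. Qed.
Let L0 : 0 <= L. Proof. by rewrite /L addr_ge0 // ltW. Qed.

Let G (delta : R) := fun p => delta * f p + g p.

Let regG (delta : R) : 0 <= delta -> 2 * lf1 * delta <= mug ->
  (forall p, grad (G delta) p = delta *: grad f p + grad g p)
  /\ regular L mu (G delta).
Proof. by case: S2 => _ lf lg; exact: regular_penalized. Qed.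

Let regg : regular L mu g.
Proof.
have -> : g = G 0 by apply/funext => p; rewrite /G mul0r add0r.
by apply: (proj2 (regG (lexx 0) _)); rewrite mulr0 ltW.
Qed.

(** The energy of the distance to the optimal pair contracts at each step, hence
    falls below the square of [c1 * eps <= delta] after [O(ln eps^-1)] steps. *)
Lemma pgd_complexity : exists tau sigma : R, 0 < tau /\ 0 < sigma /\
  forall zs vs, exists (Na : R -> nat) (Ka : R),
  (forall eps, 0 < eps < expR (- 1) -> (Na eps)%:R <= Ka * ln eps^-1) /\
  forall eps delta, 0 < eps -> c1 * eps <= delta ->
    accurate g A B b delta x0 (pgd g A B b tau sigma x0 (zs, vs) (Na eps)).
Proof.
have [tau [sigma [theta [lo [up [[t0 s0 th lo0 up0] bnd step]]]]]] :=
  pgd_map_contraction B b fullA L0 mu0.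
have [y [u K]] := kkt_exists B b fullA x0 L0 mu0 regg.
exists tau, sigma; split=> //; split=> // zs vs.
pose P (s : 'cV[R]_dy * 'cV[R]_dh) := energy A tau sigma (s.1 - y) (s.2 - u).
have P0 s : 0 <= P s.
  apply: le_trans (proj1 (andP (bnd _ _))).
  by rewrite mulr_ge0 ?(ltW lo0) // addr_ge0 ?dot_ge0.
have th1 : theta <= 1 by case/andP: th => _ /ltW.
have Pstep s : P (pgd_step g A B b tau sigma x0 s) <= (1 - theta) * P s.
  rewrite (pgd_stepE _ _ _ _ _ _ _ L0 regg).
  by have := step g x0 s (y, u) regg; rewrite (kkt_pgd_map _ s0 K).
have D0 : 0 < P (zs, vs) / lo + 1.
  by rewrite ltr_wpDl // divr_ge0 // ltW.
have [Na [Ka [rate small]]] := geometric_count th D0 c1_gt0.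
exists Na, Ka; split=> // eps delta e0 ed.
have d0 : 0 <= delta by apply: le_trans ed; rewrite mulr_ge0 // ltW.
have := iter_contraction th1 Pstep (Na eps) (zs, vs).
rewrite -/(pgd g A B b tau sigma x0 (zs, vs) (Na eps)).
set s := pgd _ _ _ _ _ _ _ _ _ => Ps.
have sum : dot (s.1 - y) (s.1 - y) + dot (s.2 - u) (s.2 - u) <= delta ^+ 2.
  rewrite -(ler_pM2l lo0); apply: le_trans (proj1 (andP (bnd _ _))) _.
  apply: (le_trans Ps).
  apply: (@le_trans _ _ (lo * ((1 - theta) ^+ Na eps * (P (zs, vs) / lo + 1)))).
    rewrite mulrCA ler_wpM2l ?exprn_ge0 ?subr_ge0 //.
    by rewrite mulrDr mulr1 mulrCA divff ?gt_eqF // mulr1 lerDl ltW.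
  rewrite ler_pM2l //; apply: le_trans (small _ e0) _.
  by rewrite ler_sqr // nnegrE mulr_ge0 // ltW.
rewrite /accurate (ystar_kkt L0 regg S3 K) (vstar_kkt L0 fullA regg S3 K).
by split; apply: enorm_le => //; apply: le_trans sum;
  rewrite ?lerDl ?lerDr dot_ge0.
Qed.

(** The potential is [delta] times the penalized objective plus the energies.
    Its initial value exceeds its infimum by at most [delta] times the gap of
    the bilevel objective plus [Cd * delta ^+ 2]: the
    minimizers of [delta f + g] and [g] are [O(delta)] apart, so that exchanging
    them changes [delta f] by [O(delta ^+ 2)], and the warm start is within
    [O(delta)] of both, so that the energies are [O(delta ^+ 2)]. On the other
    hand the squared gradient has to fall below [(delta * eps) ^+ 2], and
    [delta / (delta * eps) ^+ 2] is of order [eps ^- 3]. *)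
Lemma sflcb_complexity : exists eta sigma eta_x : R,
  [/\ 0 < eta, 0 < sigma & 0 < eta_x] /\
  exists (Nb : R -> nat) (Kb : R),
  (forall eps, 0 < eps < expR (- 1) -> (Nb eps)%:R <= Kb * eps ^- 3) /\
  forall eps delta zv, 0 < eps -> c1 * eps <= delta -> 2 * lf1 * delta <= mug ->
    accurate g A B b delta x0 zv ->
    exists2 t : nat, (t <= Nb eps)%N & stationary eps (Phi_pen f g A B b delta)
      (st_x (sflcb f g A B b delta 1 1 eta_x eta eta sigma sigma
               (sflcb_init A B b x0 zv.1 zv.2) t)).
Proof.
have [eta [sigma [eta_x [up [[e0 s0 ex0 up0] bnd descent]]]]] :=
  sflcb_descent B b fullA L0 mu0.
have energy_ge0 w u : 0 <= energy (slack_mx A) eta sigma w u.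
  by case/andP: (bnd w u).
have energy_le w u : energy (slack_mx A) eta sigma w u <= up * (dot w w + dot u u).
  by case/andP: (bnd w u).
exists eta, sigma, eta_x; split=> //.
have [yg ygP] := choice (fun x => kkt_exists B b fullA x L0 mu0 regg).
have [ug Kg] := choice ygP.
have ysE x : ystar g A B b x = yg x := ystar_kkt L0 regg S3 (Kg x).
have vsE x : vstar g A B b x = ug x := vstar_kkt L0 fullA regg S3 (Kg x).
have [_ [m mP]] := S1.
have {}mP x : m <= f (col_mx x (yg x)).
  have := mP (Phi f g A B b x); rewrite /Phi ysE; apply.
  by exists x => //; rewrite /Phi ysE.
have [cp cp0 cpP] := kkt_perturb B b fullA L0 mu0.
have [a a0 aP] := mulmx_bounded A.
have gap0 : 0 <= f (col_mx x0 (yg x0)) - m by rewrite subr_ge0.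
pose Cg2 : R := up * ((1 + a ^+ 2) + 1).
pose CG2 : R := up * ((1 + a ^+ 2) * (1 + lf0 / mu) ^+ 2 + (1 + cp * lf0) ^+ 2).
pose Cd : R := lf0 ^+ 2 / mu + CG2 + Cg2.
have Cg20 : 0 <= Cg2.
  exact: mulr_ge0 (ltW up0) (addr_ge0 (addr_ge0 ler01 (sqr_ge0 a)) ler01).
have CG20 : 0 <= CG2.
  exact: mulr_ge0 (ltW up0) (addr_ge0 (mulr_ge0
    (addr_ge0 ler01 (sqr_ge0 a)) (sqr_ge0 _)) (sqr_ge0 _)).
have Cd0 : 0 <= Cd.
  by rewrite addr_ge0 // addr_ge0 // divr_ge0 ?sqr_ge0 // ltW.
have k1 : 0 <= 2 / eta_x * ((f (col_mx x0 (yg x0)) - m) / c1).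
  by rewrite !mulr_ge0 ?invr_ge0 ?(ltW ex0) ?(ltW c1_gt0).
have k2 : 0 <= 2 / eta_x * Cd by rewrite !mulr_ge0 ?invr_ge0 ?(ltW ex0).
have [Nb [Kb [rate NbP]]] := polynomial_count k1 k2.
exists Nb, Kb; split=> // eps delta zv eps0 ed dmu acc.
have d0 : 0 < delta by apply: lt_le_trans ed; rewrite mulr_gt0.
have [gradG rG] := regG (ltW d0) dmu.
have [yG yGP] := choice (fun x => kkt_exists B b fullA x L0 mu0 rG).
have [uG KG] := choice yGP.
pose Psi x := G delta (col_mx x (yG x)) - g (col_mx x (yg x)).
pose dPsi x := env_grad B (G delta) x (yG x) (uG x)
  - env_grad B g x (yg x) (ug x).
have [PsiQ dec] : (forall x, qgrad Psi x (dPsi x)) /\ _ :=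
  descent _ _ _ _ _ _ rG regg KG Kg.
(* The two lower-level objectives differ by [delta f], whose gradient is
   bounded by [lf0]. *)
have near x : mu * enorm (yG x - yg x) <= delta * lf0 /\
    enorm (uG x - ug x) <= cp * (delta * lf0).
  apply: cpP rG (KG x) (Kg x) _.
  have -> : grady (G delta) x (yg x) - grady g x (yg x)
      = dsubmx (delta *: grad f (col_mx x (yg x))).
    by rewrite /grady gradG -dsubmxB addrK.
  apply: le_trans (enorm_dsub _) _; rewrite enormZ gtr0_norm // ler_pM2l //.
  have [lf lf' _] := S2; have [df _] := Cf.
  by apply: (grad_le lf lf10) => k; exact: qgrad_lipschitz.
have near' x : enorm (yG x - yg x) <= delta * (lf0 / mu).
  by rewrite mulrA ler_pdivlMr // mulrC; case: (near x).
pose lb := delta * m - delta ^+ 2 * (lf0 ^+ 2 / mu).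
have Psi_lb x : lb <= Psi x.
  have fdist : f (col_mx x (yg x)) - f (col_mx x (yG x)) <=
      lf0 * (delta * (lf0 / mu)).
    have [[_ lf] _ _] := S2; apply: le_trans (ler_norm _) _.
    apply: le_trans (lf _ _) _; rewrite ler_wpM2l //.
    rewrite opp_col_mx add_col_mx subrr enorm_0col_mx enorm_subC.
    exact: near'.
  have gmin : g (col_mx x (yg x)) <= g (col_mx x (yG x)).
    by apply: kkt_min regg (Kg x) _; exact: kkt_primal (KG x).
  have H1 := ler_wpM2l (ltW d0) fdist.
  have H2 := ler_wpM2l (ltW d0) (mP x).
  rewrite /lb /Psi /G; move: H1 H2 gmin.
  by lra.
pose V (s : sflcb_state R dx dy dh) := Psi (st_x s)
  + energy (slack_mx A) eta sigma
      (st_y s - slack_point A B b (st_x s) (yG (st_x s))) (st_u s - uG (st_x s))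
  + energy (slack_mx A) eta sigma
      (st_z s - slack_point A B b (st_x s) (yg (st_x s))) (st_v s - ug (st_x s)).
pose step := sflcb_step f g A B b delta 1 1 eta_x eta eta sigma sigma.
pose st := sflcb f g A B b delta 1 1 eta_x eta eta sigma sigma
  (sflcb_init A B b x0 zv.1 zv.2).
pose gsq (s : sflcb_state R dx dy dh) : R := dot (dPsi (st_x s)) (dPsi (st_x s)).
have Vstep s : V (step s) <= V s - eta_x / 2 * gsq s.
  case: s => x w z u v; rewrite /step.
  rewrite (sflcb_stepE A B b eta_x eta sigma x w z u v L0 rG regg).
  exact: dec x w z u v.
have Vlb s : lb <= V s.
  apply: le_trans (Psi_lb (st_x s)) _; rewrite /V -addrA lerDl.
  by rewrite addr_ge0.
have slackd (x : 'cV[R]_dx) (y y' : 'cV[R]_dy) :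
  dot (slack_point A B b x y - slack_point A B b x y')
    (slack_point A B b x y - slack_point A B b x y')
    <= (1 + a ^+ 2) * dot (y - y') (y - y').
  rewrite opp_col_mx add_col_mx dot_col_mx constrBy mulrDl mul1r lerD2l.
  by rewrite -(enorm_sq (y - y')) -exprMn; exact/dot_le/aP.
have init_energy (y : 'cV[R]_dy) (v : 'cV[R]_dh) (r1 r2 : R) : 0 <= r1 -> 0 <= r2 ->
    enorm (zv.1 - y) <= delta * r1 -> enorm (zv.2 - v) <= delta * r2 ->
    energy (slack_mx A) eta sigma
      (slack_point A B b x0 zv.1 - slack_point A B b x0 y) (zv.2 - v)
    <= delta ^+ 2 * (up * ((1 + a ^+ 2) * r1 ^+ 2 + r2 ^+ 2)).
  move=> r10 r20 /dot_le D1 /dot_le D2.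
  apply: le_trans (energy_le _ _) _.
  rewrite mulrCA ler_pM2l // mulrDr lerD //; last by rewrite -exprMn.
  apply: le_trans (slackd _ _ _) _.
  by rewrite mulrCA -exprMn ler_wpM2l // addr_ge0 // sqr_ge0.
have [acc_v acc_z] := acc; rewrite vsE ysE in acc_v acc_z.
have lm0 : 0 <= lf0 / mu by rewrite divr_ge0 // ltW.
have EG : energy (slack_mx A) eta sigma (slack_point A B b x0 zv.1
    - slack_point A B b x0 (yG x0)) (zv.2 - uG x0) <= delta ^+ 2 * CG2.
  have r20 : 0 <= 1 + cp * lf0 by rewrite addr_ge0 // mulr_ge0.
  apply: init_energy (addr_ge0 ler01 lm0) r20 _ _.
    have -> : zv.1 - yG x0 = (zv.1 - yg x0) + (yg x0 - yG x0).
      by rewrite addrA subrK.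
    apply: le_trans (enormD _ _) _; rewrite mulrDr mulr1 lerD //.
    by rewrite enorm_subC.
  have -> : zv.2 - uG x0 = (zv.2 - ug x0) + (ug x0 - uG x0).
    by rewrite addrA subrK.
  apply: le_trans (enormD _ _) _; rewrite mulrDr mulr1 lerD //.
  by rewrite enorm_subC mulrCA; case: (near x0).
have Eg : energy (slack_mx A) eta sigma (slack_point A B b x0 zv.1
    - slack_point A B b x0 (yg x0)) (zv.2 - ug x0) <= delta ^+ 2 * Cg2.
  have := @init_energy (yg x0) (ug x0) 1 1; rewrite !expr1n !mulr1.
  by apply.
have Psi0 : Psi x0 <= delta * f (col_mx x0 (yg x0)).
  have := kkt_min rG (KG x0) (kkt_primal (Kg x0)).
  by rewrite /Psi /G; lra.
have V0 : V (st 0%N) - lb <=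
    (Nb eps)%:R * (eta_x / 2 * (delta * eps) ^+ 2).
  apply: (@le_trans _ _ (delta * (f (col_mx x0 (yg x0)) - m) + delta ^+ 2 * Cd)).
    have VE : V (st 0%N) = Psi x0 + energy (slack_mx A) eta sigma
      (slack_point A B b x0 zv.1 - slack_point A B b x0 (yG x0)) (zv.2 - uG x0)
      + energy (slack_mx A) eta sigma
      (slack_point A B b x0 zv.1 - slack_point A B b x0 (yg x0)) (zv.2 - ug x0).
      by [].
    by rewrite VE /lb /Cd; lra.
  have NP := NbP _ eps0.
  have w0 : 0 <= eta_x / 2 * (delta * eps) ^+ 2.
    by rewrite mulr_ge0 ?sqr_ge0 // divr_ge0 // ltW.
  apply: le_trans (ler_wpM2r w0 NP).
  have -> : (2 / eta_x * ((f (col_mx x0 (yg x0)) - m) / c1) / eps + 2 / eta_x * Cd)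
      / eps ^+ 2 * (eta_x / 2 * (delta * eps) ^+ 2)
    = delta * ((f (col_mx x0 (yg x0)) - m) * (delta / (c1 * eps)))
      + delta ^+ 2 * Cd.
    by field; rewrite !gt_eqF.
  rewrite lerD2r ler_pM2l // ler_peMr // ler_pdivlMr ?mul1r //.
  by rewrite mulr_gt0.
have s1 : 0 < eta_x / 2 * (delta * eps) ^+ 2.
  by rewrite mulr_gt0 ?exprn_gt0 ?mulr_gt0 // divr_gt0.
have [t tN small] := @telescope_exists R (fun t => V (st t))
  (fun t => eta_x / 2 * gsq (st t)) _ _ _ (fun t => Vstep (st t))
  (fun t => Vlb (st t)) V0 s1.
exists t => //; rewrite -/st.
move: small; rewrite ler_pM2l ?divr_gt0 // /gsq => small.
have PhiE x : Phi_pen f g A B b delta x = delta^-1 * Psi x.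
  exact: Phi_penE d0 rG regg (KG x) (Kg x).
have q := qgradZ delta^-1 (PsiQ (st_x (st t))).
have [dP gP] := qgrad_diff (qgrad_eq (fun x => esym (PhiE x)) erefl q).
split=> //; rewrite gP enormZ gtr0_norm ?invr_gt0 // ler_pdivrMl //.
by apply: enorm_le => //; rewrite mulr_ge0 // ltW.
Qed.

End Complexity.

Theorem corollary5p3 (R : realType) (dx dy dh : nat)
    (f g : 'cV[R]_(dx + dy) -> R)
    (A : 'M[R]_(dh, dy)) (B : 'M[R]_(dh, dx)) (b : 'cV[R]_dh)
    (lf0 lf1 lg1 mug c1 c2 : R) (x0 : 'cV[R]_dx)
    (Cf : continuously_differentiable f)
    (Cg : continuously_differentiable g)
    (fullA : row_free A)
    (S1 : assumption_S1 f g A B b)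
    (S2 : assumption_S2 f g lf0 lf1 lg1)
    (S3 : assumption_S3 g mug)
    (c1_gt0 : 0 < c1) (c1_le_c2 : c1 <= c2) :
  exists tau sigma rho1 rho2 eta_x eta_y eta_z eta_u eta_v : R,
    [/\ 0 < tau, 0 < sigma, 0 < rho1 & 0 < rho2] /\
    [/\ 0 < eta_x, 0 < eta_y, 0 < eta_z, 0 < eta_u & 0 < eta_v] /\
    forall (zs : 'cV[R]_dy) (vs : 'cV[R]_dh), nonneg_orthant vs ->
    exists Na Nb : R -> nat,
      [/\ (fun eps : R => (Na eps)%:R : R^o) =O_ (0^'+)
            (fun eps : R => ln (eps^-1) : R^o),
          (fun eps : R => (Nb eps)%:R : R^o) =O_ (0^'+)
            (fun eps : R => eps ^- 3 : R^o),
          (fun eps : R => (Na eps + Nb eps)%:R : R^o) =O_ (0^'+)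
            (fun eps : R => eps ^- 3 + ln (eps^-1) : R^o)
        & (fun eps : R => (Na eps + Nb eps)%:R : R^o) =O_ (0^'+)
            (fun eps : R => eps ^- 3 : R^o)] /\
      forall eps delta : R, 0 < eps ->
        c1 * eps <= delta <= c2 * eps -> 2 * lf1 * delta <= mug ->
        (exists2 k : nat, (k <= Na eps)%N
           & accurate g A B b delta x0 (pgd g A B b tau sigma x0 (zs, vs) k)) /\
        (forall k : nat,
           let zv := pgd g A B b tau sigma x0 (zs, vs) k in
           accurate g A B b delta x0 zv ->
           exists2 t : nat, (t <= Nb eps)%N
             & stationary eps (Phi_pen f g A B b delta)
                 (st_x (sflcb f g A B b delta rho1 rho2
                          eta_x eta_y eta_z eta_u eta_v
                          (sflcb_init A B b x0 zv.1 zv.2) t))).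
Proof.
have [tau [sigma [tau0 [sigma0 phase1]]]] :=
  pgd_complexity B b x0 Cf Cg fullA S2 S3 c1_gt0.
have [eta [nu [eta_x [[eta0 nu0 eta_x0] [Nb [Kb [rateb phase2]]]]]]] :=
  sflcb_complexity x0 Cf Cg fullA S1 S2 S3 c1_gt0.
exists tau, sigma, 1, 1, eta_x, eta, eta, nu, nu.
split; first by [].
split; first by [].
move=> zs vs _; have [Na [Ka [ratea phase1P]]] := phase1 zs vs.
exists Na, Nb; split; first exact: complexity_bigO ratea rateb.
move=> eps delta eps0 /andP[ed _] dmu; split.
  by exists (Na eps) => //; exact: phase1P.
by move=> k /= acc; exact: phase2.
Qed.
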